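(* Let $0<a<b<+\infty$ and let $\varrho\ge0$ be a non-decreasing bounded function on $[a,b]$. Suppose that $(w,\lambda)$, with $w:[a,b]\to\mathbb{R}$ Lipschitz and $\lambda\in\mathbb{R}$, solves $$w'+\lambda w^2=(1/x+\varrho)w\ \text{ a.e. on }(a,b),\qquad w(a)=w(b)=1,$$ and let $w_0$ denote the solution function of this problem in the case $\varrho\equiv0$ on $[a,b]$. Assume that $w>1$ on $(a,b)$. Let $0\le\varphi\in C^1((1,+\infty))$ be strictly decreasing with $\int_a^b\varphi(w_0)\,d\mu<+\infty$. Then (i) $\int_a^b\varphi(w)\,d\mu\ge\int_a^b\varphi(w_0)\,d\mu$; (ii) equality holds in (i) if and only if $\varrho\equiv0$ on $[a,b)$. In particular, (iii) $\int_a^b\frac{1}{\sqrt{w^2-1}}\,d\mu\ge\pi$ with equality if and only if $\varrho\equiv0$ on $[a,b)$.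
   Context: The measure $\mu$ on the Lebesgue measurable subsets of $[0,+\infty)$ is $\mu(dx)=(1/x)\,dx$. The boundary value problem in the statement has, for each such $\varrho$ (including $\varrho\equiv0$), a unique solution pair $(w,\lambda)$ with $w$ Lipschitz on $[a,b]$. *)

(* Defs.v *)
From HB Require Import structures.
From mathcomp Require Import all_boot all_order all_algebra.
From mathcomp Require Import all_classical all_reals all_analysis.
From mathcomp Require Import measurable_realfun.
Set Implicit Arguments.
Unset Strict Implicit.
Unset Printing Implicit Defensive.
Import Order.TTheory GRing.Theory Num.Theory.
Import numFieldNormedType.Exports.
Local Open Scope classical_set_scope.
Local Open Scope ring_scope.

(* [lebesgue_measure] lives on the Borel sets only; the Lebesgue measurable
   sets are the Caratheodory measurable ones, on which the library defines
   [completed_lebesgue_measure]. *)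
Definition lebesgueTypeR (R : realType) : measurableType _ :=
  caratheodory_type ((@wlength R idfun)^*)%mu.

(* mu(dx) = (1/x) dx, extended by zero to the Lebesgue measurable subsets of
   the whole line; the point 0, where the density is undefined, is null. *)
Definition invx_measure (R : realType) (A : set (lebesgueTypeR R)) : \bar R :=
  (\int[@completed_lebesgue_measure R]_(x in A `&` `]0%R, +oo[%classic)
     ((x : R)^-1)%:E)%E.
Arguments invx_measure : clear implicits.

Section invx_measure_is_measure.
Context {R : realType}.
Local Notation mu := (invx_measure R).

Let mu0 : mu set0 = 0%E.
Proof. by rewrite /invx_measure set0I integral_set0. Qed.

Let mu_ge0 A : (0 <= mu A)%E.
Proof.
apply: integral_ge0 => x [_] /=; rewrite in_itv /= andbT => x0.
by rewrite lee_fin invr_ge0 ltW.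
Qed.

Let measurable_to_borel : measurable_fun [set: lebesgueTypeR R]
  (idfun : lebesgueTypeR R -> measurableTypeR R).
Proof. by move=> _ A mA; rewrite setTI; exact: sub_caratheodory. Qed.

Let measurable_itvpos :
  measurable (`]0%R, +oo[%classic : set (lebesgueTypeR R)).
Proof.
have := measurable_to_borel measurableT (@measurable_itv R `]0%R, +oo[).
by rewrite setTI.
Qed.

Let measurable_density (D : set (lebesgueTypeR R)) :
  D `<=` `]0%R, +oo[%classic -> measurable D ->
  measurable_fun D
    ((fun x : R => x^-1) : lebesgueTypeR R -> measurableTypeR R).
Proof.
move=> Dpos mD.
apply: (@measurable_funS _ _ (lebesgueTypeR R) (measurableTypeR R)
  `]0%R, +oo[%classic) => //.
apply: (@measurable_comp _ _ _ (lebesgueTypeR R) (measurableTypeR R)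
  (measurableTypeR R) `]0%R, +oo[%classic (fun x : R => x^-1) _ idfun) => //.
- apply: open_continuous_measurable_fun => [|x]; first exact: interval_open.
  rewrite inE /= in_itv /= andbT => x0.
  by apply: inv_continuous; rewrite gt_eqF.
- exact: measurable_funTS.
Qed.

Let mu_semi_sigma_additive : semi_sigma_additive mu.
Proof.
move=> F mF tF mUF; rewrite /invx_measure setI_bigcupl ge0_integral_bigcup//=.
- by apply: is_cvg_ereal_nneg_natsum_cond => n _ _; exact: mu_ge0.
- by move=> n; apply: measurableI.
- apply/measurable_EFinP.
  apply: measurable_density; first by move=> x [n _ []].
  by apply: bigcup_measurable => n _; apply: measurableI.
- move=> x [n _] [_] /=; rewrite in_itv /= andbT => x0.
  by rewrite lee_fin invr_ge0 ltW.
- exact: trivIset_setIr.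
Qed.

HB.instance Definition _ := isMeasure.Build _ _ _ mu
  mu0 mu_ge0 mu_semi_sigma_additive.

End invx_measure_is_measure.

(* Functions on [a, b] are total functions of which only the values on [a, b]
   matter. [derive1] is total, hence the explicit derivability. *)
Definition solves_bvp (R : realType) (a b : R) (rho w : R -> R) (lambda : R) :
    Prop :=
  [/\ [lipschitz w x | x in `[a, b]],
      {ae lebesgue_measure, forall x : R, x \in `]a, b[ ->
        derivable w x 1 /\
        derive1 w x + lambda * w x ^+ 2 = (x^-1 + rho x) * w x},
      w a = 1
    & w b = 1].

(* Both clauses are two-sided at every point, so [I] is meant to be open. *)
Definition C1_on (R : realType) (I : interval R) (f : R -> R) : Prop :=
  {in I, forall x, derivable f x 1} /\ {in I, continuous (derive1 f)}.

(* Main.v *)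
(** Write [Q x y = (x + y)^2 / (x y)]; it depends on [y / x] only and is
    increasing in it.  For [rho = 0] the solution is
    [w0 x = (a + b) x / (x^2 + a b)], whose superlevel sets [{w0 >= t}] are the
    intervals [[y1, y2]] with [t^2 Q y1 y2 = Q a b].  The theorem follows, through
    the layer cake formula for the decreasing [phi], from the fact that for every
    solution [w] the hull [[al, be]] of [{w >= t}] satisfies
    [t^2 Q al be <= Q a b], so that [mu {w >= t} <= mu {w0 >= t}].

    To see it, lower [t] from the given level to [1] and follow [al] and [be].
    Since [w / t] solves the same problem on [[al, be]] with [lambda t] in place of
    [lambda], a comparison with the explicit solution for [rho = 0] gives
    [lambda t <= 2 / (al + be) + rho be].  As [rho] is monotone this bounds the
    sum of the logarithmic slopes of [w] at [al] and [be], and the inequality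
    between the harmonic and the arithmetic mean shows that [t^2 Q al be] increases
    along the way.  The inequalities are strict as soon as [rho be > 0]. *)

Require Import Defs.
From HB Require Import structures.
From mathcomp Require Import all_boot all_order all_algebra.
From mathcomp Require Import all_classical all_reals all_analysis.
From mathcomp Require Import measurable_realfun.
From mathcomp Require Import ring lra.
Set Implicit Arguments.
Unset Strict Implicit.
Unset Printing Implicit Defensive.
Import Order.TTheory GRing.Theory Num.Theory.
Import numFieldNormedType.Exports.
Local Open Scope classical_set_scope.
Local Open Scope ring_scope.

(** * Lipschitz functions and almost everywhere derivatives *)

(** Two obstacles shape the descent in [t]. The hull of [{w >= t}] may jump as [t] falls, because
    [w] may have several humps, and [w] is derivable only almost everywhere; so [al] and [be] are
    not differentiated in [t]. One finite step is made instead: linear lower bounds of [w] just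
    outside the hull yield a lower level with a wider pair of points, and an infimum over admissible
    levels turns such steps into the whole descent. A step needs a strict gain, whereas for
    [rho = 0] equality holds all the way. Replacing [t^2] by [(t + eta)^2] with [eta > 0] supplies
    the gain, since lowering [t] then costs relatively less; [eta] tends to 0 at the end. The strict
    inequality comes from a single step with [eta = 0], possible where [rho be > 0], followed by the
    weak inequality at the lower level. *)

Definition lip_on (R : realType) (f : R -> R) (c d : R) :=
  exists2 K, 0 <= K &
    {in `[c, d] &, forall x y, `|f x - f y| <= K * `|x - y|}.

(** Continuous induction on the supremum of the points where [g c <= g x]. The bound with [K] only
    forbids sudden drops of [g], which is enough to carry the inequality to the supremum; the local
    condition then pushes past it. *)
Lemma right_locally_nondecreasing_le (R : realType) (g : R -> R) (c d K : R) :
  c <= d ->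
  (forall x y, c <= x -> x <= y -> y <= d -> g x - K * (y - x) <= g y) ->
  (forall x, c <= x -> x < d -> exists2 e, 0 < e &
     forall y, x < y -> y < x + e -> y <= d -> g x <= g y) ->
  g c <= g d.
Proof.
move=> cd gK gloc.
pose A := [set x | [/\ c <= x, x <= d & g c <= g x]].
have Ac : A c by split.
have supA : has_sup A by split; [exists c | exists d => x []].
have cs : c <= sup A by apply: sup_upper_bound.
have sd : sup A <= d by apply: ge_sup; [exists c | move=> x []].
have gs : g c <= g (sup A).
  apply/ler_addgt0Pr => e e0.
  have K1 : 0 < `|K| + 1 by rewrite ltr_wpDl.
  have [x Ax xs] := sup_adherent (divr_gt0 e0 K1) supA.
  have xs' : x <= sup A by apply: sup_upper_bound.
  case: Ax => cx xd gx; have := gK _ _ cx xs' sd.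
  have : K * (sup A - x) <= e.
    apply: (@le_trans _ _ ((`|K| + 1) * (sup A - x))).
      by apply: ler_wpM2r; [lra | have := ler_norm K; lra].
    by rewrite -ler_pdivlMl// mulrC; lra.
  lra.
have [sltd|] := ltP (sup A) d; last first.
  by move=> ds; have -> : d = sup A by lra.
have [e e0 ge] := gloc _ cs sltd.
pose y := Num.min (sup A + e / 2) d.
have yd : y <= d by rewrite /y ge_min lexx orbT.
have sy : sup A < y by rewrite /y lt_min sltd andbT; lra.
have ye : y < sup A + e.
  by apply: (@le_lt_trans _ _ (sup A + e / 2)); [rewrite /y ge_min lexx | lra].
have Ay : A y by split; [lra | lra | have := ge _ sy ye yd; lra].
by have := sup_upper_bound supA Ay; lra.
Qed.

(* Cover the exceptional null set by an open set [U] of small measure: adding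
   [K |U `&` [c, x]|] to [f] compensates the possible decrease of [f] on [U]. *)
Lemma ae_derive_ge0_le (R : realType) (f : R -> R) (c d : R) :
  c <= d -> lip_on f c d ->
  {ae lebesgue_measure, forall x : R, x \in `]c, d[ ->
     exists2 l, is_derive x 1 f l & 0 <= l} ->
  f c <= f d.
Proof.
move=> cd [K K0 fK] [N [mN N0 fN]].
apply/ler_addgt0Pr => e0 e0_gt0.
pose e := e0 / (K + 1 + (d - c)).
have den : 0 < K + 1 + (d - c) by lra.
have e_gt0 : 0 < e by rewrite divr_gt0.
(* The derivative is given on the open interval only; [c] is made exceptional so that every point of
   [[c, d[] outside [U] has one. *)
pose N1 := N `|` [set c].
have mN1 : measurable N1 by apply: measurableU.
have N10 : lebesgue_measure N1 = 0%E.
  apply/eqP; rewrite eq_le measure_ge0 andbT.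
  rewrite (le_trans (measureU2 _ _ _))//.
  by rewrite [X in (X + _)%E]N0 [X in (_ + X)%E]lebesgue_measure_set1 adde0.
have [|U [oU N1U Ue]] := lebesgue_regularity_outer mN1 _ e_gt0.
  by rewrite [X in (X < _)%E]N10.
have mU : measurable U by exact: open_measurable.
have {}Ue : (lebesgue_measure U < e%:E)%E.
  rewrite (_ : U = (U `\` N1) `|` N1); last by rewrite setUC setDUK.
  rewrite (le_lt_trans (measureU2 _ _ _))//; first exact: measurableD.
  by rewrite [X in (_ + X)%E]N10 adde0.
have Ufin (V : set R) : measurable V -> (lebesgue_measure (U `&` V) < +oo)%E.
  move=> mV; rewrite (le_lt_trans _ (ltry e))//.
  rewrite (le_trans _ (ltW Ue))// le_measure ?inE//; exact: measurableI.
pose m x := fine (lebesgue_measure (U `&` `]c, x])).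
have mE x y : c <= x -> x <= y ->
    m y = m x + fine (lebesgue_measure (U `&` `]x, y])).
  move=> cx xy; rewrite /m -fineD ?ge0_fin_numE ?Ufin//.
  rewrite -measureU//; [|exact: measurableI|exact: measurableI|]; last first.
    rewrite -subset0 => z [[_ /=]] + [_ /=]; rewrite !in_itv/= => /andP[_ zx].
    by move=> /andP[xz]; lra.
  rewrite -setIUr; congr (fine (lebesgue_measure (U `&` _))).
  apply/seteqP; split=> z /=; rewrite !in_itv/=.
    by move=> /andP[cz zy]; have [zx|zx] := leP z x; [left|right]; lra.
  by move=> [] /andP[? ?]; lra.
have m_ge0 x : 0 <= m x by apply: fine_ge0; exact: measure_ge0.
have mle x : m x <= e.
  rewrite /m -lee_fin fineK ?ge0_fin_numE ?Ufin//.
  rewrite (le_trans _ (ltW Ue))// le_measure ?inE//; exact: measurableI.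
have minc x y : c <= x -> x <= y -> m x <= m y.
  by move=> cx xy; rewrite (mE x y)// lerDl fine_ge0.
(* On [U] the measure term outweighs the Lipschitz loss [K * (y - x)]; off [U] the slope [e]
   compensates a difference quotient known only to exceed [- e]. Both additions together stay below
   [e0], whence the choice of [e]. *)
pose g x := f x + K * m x + e * (x - c).
have fle x y : c <= x -> x <= y -> y <= d -> f x - K * (y - x) <= f y.
  move=> cx xy yd.
  have xcd : x \in `[c, d] by rewrite in_itv/= cx (le_trans xy yd).
  have ycd : y \in `[c, d] by rewrite in_itv/= yd (le_trans cx xy).
  have := fK _ _ xcd ycd.
  rewrite distrC (distrC x) [`|y - x|]ger0_norm ?subr_ge0//.
  by rewrite ler_norml => /andP[]; lra.
have : g c <= g d.
  apply: (@right_locally_nondecreasing_le _ g c d K) => //.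
    move=> x y cx xy yd; rewrite /g.
    have := fle x y cx xy yd; have := minc x y cx xy.
    move=> h1 h2; have := ler_wpM2l K0 h1.
    have : e * x <= e * y by apply: ler_wpM2l => //; lra.
    lra.
  move=> x cx xd; have [Ux|nUx] := pselect (U x).
    have [r /= r0 rU] := open_subball oU Ux.
    exists (r / 2); first by rewrite divr_gt0.
    move=> y xy yr yd; rewrite /g.
    have := fle x y cx (ltW xy) yd.
    rewrite (mE x y)//; last exact: ltW.
    have -> : U `&` `]x, y] = `]x, y]%classic.
      apply/setIidPr => z /=; rewrite in_itv/= => /andP[xz zy].
      apply: (rU (`|y - x| * 2^-1 * 2 + (r - `|y - x|) / 2)) => /=.
      - rewrite sub0r normrN gtr0_norm; last first.
          by rewrite (gtr0_norm (_ : 0 < y - x)); lra.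
        by rewrite (gtr0_norm (_ : 0 < y - x)); lra.
      - by rewrite (gtr0_norm (_ : 0 < y - x)); lra.
      - rewrite /ball/= ltr_distl (gtr0_norm (_ : 0 < y - x)); lra.
    rewrite lebesgue_measure_itv/= lte_fin xy -EFinD/=.
    have : e * x <= e * y by apply: ler_wpM2l; lra.
    lra.
  have nN1 : ~ N1 x by move=> /N1U.
  have xc : x \in `]c, d[.
    rewrite in_itv/= xd andbT lt_neqAle cx andbT; apply/eqP => cx'.
    by apply: nN1; right.
  have [l dfx l0] : exists2 l, is_derive x 1 f l & 0 <= l.
    apply: contrapT => h; apply: nN1; left; apply: fN => /=.
    by move=> h'; apply: h; apply: h'.
  have dcvg : h^-1 *: (f (h + x) - f x) @[h --> 0^'] --> l.
    rewrite -(@derive_val _ _ _ _ _ _ _ dfx).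
    have := @ex_derive _ _ _ _ _ _ _ dfx; rewrite /derivable /derive.
    rewrite (_ : (fun h : R => h^-1 *: (f (h *: 1 + x) - f x)) =
      (fun h : R => h^-1 *: (f (h + x) - f x)))//.
    by apply/funext => h /=; rewrite [h *: 1]mulr1.
  have Ne : - e < l by lra.
  have : \forall h \near 0^', - e < h^-1 *: (f (h + x) - f x).
    exact: cvgr_gt dcvg _ Ne.
  rewrite near_withinE => /nbhs_ballP [r /= r0 rP].
  exists r => // y xy yr yd; rewrite /g.
  have yx0 : 0 < y - x by lra.
  have yxr : ball 0 r (y - x) by rewrite /ball/= sub0r normrN gtr0_norm//; lra.
  have := rP _ yxr (lt0r_neq0 yx0).
  rewrite /= subrK ltr_pdivlMl//.
  have := ler_wpM2l K0 (minc x y cx (ltW xy)).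
  lra.
rewrite /g subrr mulr0 addr0.
have := m_ge0 c; move=> /(mulr_ge0 K0); have := ler_wpM2l K0 (mle d).
have : e * (d - c) + e * K <= e0.
  rewrite -mulrDr {1}/e -mulrAC ler_pdivrMr//; apply: ler_wpM2l; lra.
lra.
Qed.

Section lip_on_theory.
Context {R : realType}.
Implicit Types (f g : R -> R) (c d : R).

Lemma lip_on_lipschitz f c d : [lipschitz f x | x in `[c, d]] -> lip_on f c d.
Proof.
(* [lipschitz] grants every constant strictly above [M], hence the added 1. *)
move=> [M [Mreal fM]]; exists (Num.max M 0 + 1).
  by rewrite addr_ge0// le_max lexx orbT.
move=> x y xcd ycd; apply: (fM _ _ (x, y)) => //=.
by rewrite ltr_pwDr// le_max lexx.
Qed.

Lemma lip_on_subset f c d c' d' :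
  c <= c' -> d' <= d -> lip_on f c d -> lip_on f c' d'.
Proof.
move=> cc' dd' [K K0 fK]; exists K => // x y.
rewrite !in_itv/= => /andP[? ?] /andP[? ?].
by apply: fK; rewrite in_itv/=; apply/andP; split; lra.
Qed.

Lemma lip_on_bounded f c d : lip_on f c d ->
  exists2 M, 0 <= M & {in `[c, d], forall x, `|f x| <= M}.
Proof.
move=> [K K0 fK]; exists (`|f c| + K * `|d - c|).
  by rewrite addr_ge0// mulr_ge0.
move=> x xcd; have cd : c <= d.
  by move: xcd; rewrite in_itv/= => /andP[]; exact: le_trans.
have ccd : c \in `[c, d] by rewrite in_itv/= lexx.
have := fK _ _ xcd ccd.
move: xcd; rewrite in_itv/= => /andP[cx xd].
have := ler_wpM2l K0 (lerB xd (lexx c)).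
rewrite (ger0_norm (_ : 0 <= x - c)) ?subr_ge0//.
rewrite (ger0_norm (_ : 0 <= d - c)) ?subr_ge0//.
have := lerD (lexx `|f c|) (ler_normD (f x - f c) (f c)); rewrite subrK.
lra.
Qed.

Lemma lip_on_cst (k c d : R) : lip_on (fun=> k) c d.
Proof. by exists 0 => // x y _ _; rewrite subrr normr0 mul0r. Qed.

Lemma lip_on_id c d : lip_on id c d.
Proof. by exists 1 => // x y _ _; rewrite mul1r. Qed.

Lemma lip_onD f g c d :
  lip_on f c d -> lip_on g c d -> lip_on (fun x => f x + g x) c d.
Proof.
move=> [K K0 fK] [L L0 gL]; exists (K + L); first exact: addr_ge0.
move=> x y xcd ycd; rewrite mulrDl.
rewrite (_ : f x + g x - _ = (f x - f y) + (g x - g y)); last by ring.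
by rewrite (le_trans (ler_normD _ _))// lerD ?fK ?gL.
Qed.

Lemma lip_onM f g c d :
  lip_on f c d -> lip_on g c d -> lip_on (fun x => f x * g x) c d.
Proof.
move=> lf lg; have [M M0 fM] := lip_on_bounded lf.
have [N N0 gN] := lip_on_bounded lg.
move: lf lg => [K K0 fK] [L L0 gL]; exists (M * L + N * K).
  by rewrite addr_ge0// mulr_ge0.
move=> x y xcd ycd; rewrite mulrDl.
rewrite (_ : f x * g x - _ = f x * (g x - g y) + g y * (f x - f y)); last by ring.
rewrite (le_trans (ler_normD _ _))// !normrM -!mulrA.
by rewrite lerD// ler_pM ?mulr_ge0 ?fM ?gN ?gL ?fK.
Qed.

Lemma lip_onN f c d : lip_on f c d -> lip_on (fun x => - f x) c d.
Proof.
move=> [K K0 fK]; exists K => // x y xcd ycd.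
by rewrite -opprD normrN fK.
Qed.

Lemma lip_onV f c d m : 0 < m -> {in `[c, d], forall x, m <= `|f x|} ->
  lip_on f c d -> lip_on (fun x => (f x)^-1) c d.
Proof.
move=> m0 mf [K K0 fK]; exists (K / (m * m)).
  by rewrite mulr_ge0// invr_ge0 mulr_ge0// ltW.
move=> x y xcd ycd.
have fx : 0 < `|f x| by apply: lt_le_trans (mf _ xcd).
have fy : 0 < `|f y| by apply: lt_le_trans (mf _ ycd).
rewrite (_ : _ - _ = (f y - f x) / (f x * f y)); last first.
  by field; rewrite -!normr_gt0 fx fy.
rewrite normrM normfV distrC normrM mulrAC.
rewrite ler_pM ?invr_ge0 ?mulr_ge0 ?fK ?(ltW fx) ?(ltW fy)//.
rewrite lef_pV2 ?posrE ?mulr_gt0//.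
by apply: ler_pM; rewrite ?(ltW m0) ?mf.
Qed.

Lemma lip_on_derive f (f' : R -> R) c d M : 0 <= M ->
  (forall x : R, is_derive x 1 f (f' x)) -> {in `[c, d], forall x, `|f' x| <= M} ->
  lip_on f c d.
Proof.
move=> M0 df f'M; exists M => //.
have cf x : {for x, continuous f}.
  by apply/differentiable_continuous/derivable1_diffP; apply: ex_derive.
have main x y : x <= y -> x \in `[c, d] -> y \in `[c, d] ->
    `|f y - f x| <= M * `|y - x|.
  move=> xy xcd ycd.
  have [|z zxy ->] := @MVT_segment _ f f' x y xy (fun z _ => df z).
    by apply: continuous_subspaceT => z; exact: cf.
  rewrite normrM ler_wpM2r// f'M//.
  move: zxy xcd ycd; rewrite !in_itv/= => /andP[? ?] /andP[? ?] /andP[? ?].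
  by apply/andP; split; lra.
move=> x y xcd ycd; have [xy|/ltW yx] := leP x y; last exact: main.
by rewrite distrC (distrC x); exact: main.
Qed.

Lemma lip_on_exp q c d : lip_on (fun x => expR (q * x)) c d.
Proof.
pose f' x := expR (q * x) * q.
have df (x : R) : is_derive x 1 (fun x => expR (q * x)) (f' x).
  rewrite /f'.
  have h : is_derive x (1:R) (fun x : R => q * x) q.
    have := @is_deriveZ _ _ _ id q x 1 1 (is_derive_id _ _).
    by rewrite [q *: 1]mulr1.
  exact: (@is_derive1_comp _ expR (fun x : R => q * x)).
apply: (@lip_on_derive _ f' _ _ (expR (`|q| * (`|c| + `|d|)) * `|q|)) => //.
move=> x; rewrite in_itv/= => /andP[cx xd].
rewrite normrM ler_wpM2r// ger0_norm ?expR_ge0// ler_expR.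
rewrite (le_trans (ler_norm _))// normrM ler_wpM2l//.
rewrite ler_norml; have := ler_norm d; have := ler_norm (- c); rewrite normrN.
have := normr_ge0 c; have := normr_ge0 d.
by move=> *; apply/andP; split; lra.
Qed.

Lemma lip_on_continuous f c d x :
  c < x -> x < d -> lip_on f c d -> {for x, continuous f}.
Proof.
move=> cx xd [K K0 fK]; apply/cvgrPdist_le => e e0.
near=> y.
have ycd : y \in `[c, d].
  rewrite in_itv/=; apply/andP; split; apply/ltW; near: y.
    exact: lt_nbhsr.
  exact: lt_nbhsl.
rewrite (le_trans (fK _ _ _ ycd))//; first by rewrite in_itv/= !ltW.
rewrite (@le_trans _ _ ((K + 1) * `|x - y|))// ?ler_wpM2r ?lerDl//.
rewrite -ler_pdivlMl ?ltr_wpDl// mulrC.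
near: y; apply: (@cvgr_dist_le _ _ _ _ _ id x); first exact: cvg_id.
by rewrite divr_gt0 ?ltr_wpDl.
Unshelve. all: by end_near. Qed.

End lip_on_theory.

Section is_derive1_fun.
Context {R : realType}.
Implicit Types (f g : R -> R) (x df dg : R).

(** These restatements write the function pointwise, so that the derivative of an explicit
    expression can be assembled as a term mirroring its shape. *)
Lemma is_derive1M f g x df dg : is_derive x 1 f df -> is_derive x 1 g dg ->
  is_derive x 1 (fun y => f y * g y) (f x * dg + g x * df).
Proof. by move=> ? ?; exact: (@is_deriveM _ _ f g). Qed.

Lemma is_derive1D f g x df dg : is_derive x 1 f df -> is_derive x 1 g dg ->
  is_derive x 1 (fun y => f y + g y) (df + dg).
Proof. by move=> ? ?; exact: (@is_deriveD _ _ _ f g). Qed.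

Lemma is_derive1N f x df : is_derive x 1 f df ->
  is_derive x 1 (fun y => - f y) (- df).
Proof. by move=> ?; exact: (@is_deriveN _ _ _ f). Qed.

Lemma is_derive1_inv f x df : f x != 0 -> is_derive x 1 f df ->
  is_derive x 1 (fun y => (f y)^-1) (- (f x) ^- 2 * df).
Proof. by move=> ? ?; exact: (@is_deriveV _ f). Qed.

Lemma is_derive1_exp q x :
  is_derive x 1 (fun y => expR (q * y)) (expR (q * x) * q).
Proof.
have h : is_derive x (1:R) (fun x : R => q * x) q.
  have := @is_deriveZ _ _ _ id q x 1 1 (is_derive_id _ _).
  by rewrite [q *: 1]mulr1.
exact: (@is_derive1_comp _ expR (fun x : R => q * x)).
Qed.

End is_derive1_fun.

(** * The boundary value problem *)

Lemma ae_lebesgueS (R : realType) (P Q : R -> Prop) :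
  (forall x, P x -> Q x) ->
  {ae lebesgue_measure, forall x : R, P x} ->
  {ae lebesgue_measure, forall x : R, Q x}.
Proof.
move=> PQ; apply: filterS; last exact: PQ.
exact: (ae_filter_ringOfSetsType lebesgue_measure).
Qed.

Definition ae_ode (R : realType) (a b : R) (rho w : R -> R) (lambda : R) :=
  {ae lebesgue_measure, forall x : R, x \in `]a, b[ ->
     is_derive x 1 w ((x^-1 + rho x) * w x - lambda * w x ^+ 2)}.

Lemma solves_bvp_ae_ode (R : realType) (a b : R) (rho w : R -> R) (lambda : R) :
  solves_bvp a b rho w lambda -> ae_ode a b rho w lambda.
Proof.
move=> [_ ode _ _]; apply: ae_lebesgueS ode => x h xab.
have [dw wE] := h xab.
apply: DeriveDef => //; rewrite -derive1E -wE; ring.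
Qed.

Lemma solves_bvp_lip (R : realType) (a b : R) (rho w : R -> R) (lambda : R) :
  solves_bvp a b rho w lambda -> lip_on w a b.
Proof. by move=> [lipw _ _ _]; exact: lip_on_lipschitz. Qed.

(** This is a Bernoulli equation: [1 / w] satisfies a linear one, and [x / w - lambda x^2 / 2] has
    derivative 0. Dividing requires that [w] has no zero, which has to be shown first; the value at
    [b] then fixes [lambda]. *)
Lemma bvp0_unique (R : realType) (a b : R) (w : R -> R) (lambda : R) :
  0 < a -> a < b -> solves_bvp a b (fun=> 0) w lambda ->
  {in `[a, b], forall x, w x = (a + b) * x / (x ^+ 2 + a * b)}.
Proof.
move=> a0 ab sol; have lw := solves_bvp_lip sol.
have ode := solves_bvp_ae_ode sol.
have [_ _ wa wb] := sol.
have [M M0 wM] := lip_on_bounded lw.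
(* [K] bounds [lambda * w x - x^-1], so that [expR (2 * K * x) * (w x * w x)] is nondecreasing,
   starting from a positive value at [a]. *)
pose K := a^-1 + `|lambda| * M.
have ai0 : 0 <= a^-1 by rewrite invr_ge0 ltW.
have K0 : 0 <= K by rewrite addr_ge0 ?mulr_ge0.
have inab x y : x \in `[a, b] -> y \in `]a, x[ -> y \in `]a, b[.
  rewrite !in_itv/= => /andP[_ xb] /andP[-> yx]; exact: lt_le_trans xb.
have w2 x : x \in `[a, b] ->
    expR (2 * K * a) <= expR (2 * K * x) * (w x * w x).
  move=> xab; have := xab; rewrite in_itv/= => /andP[ax xb].
  have -> : expR (2 * K * a) = expR (2 * K * a) * (w a * w a).
    by rewrite wa !mulr1.
  apply: (@ae_derive_ge0_le _ (fun x => expR (2 * K * x) * (w x * w x))) => //.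
    have lwx : lip_on w a x by apply: lip_on_subset lw.
    by apply: lip_onM; [exact: lip_on_exp | exact: lip_onM].
  apply: ae_lebesgueS ode => y h yax; have yab := inab _ _ xab yax.
  have dw := h yab.
  eexists; first exact: is_derive1M (is_derive1_exp _ _) (is_derive1M dw dw).
  rewrite /= [leRHS](_ : _ =
    2 * expR (2 * K * y) * (w y * w y) * (y^-1 - lambda * w y + K)).
    2: by ring.
  apply: mulr_ge0.
    by rewrite -expr2 mulr_ge0 ?sqr_ge0 ?mulr_ge0 ?expR_ge0.
  have y0 : 0 < y^-1.
    by move: yax; rewrite in_itv/= invr_gt0 => /andP[]; lra.
  have : lambda * w y <= `|lambda| * M.
    rewrite (le_trans (ler_norm _))// normrM ler_wpM2l// wM//.
    by move: yab; rewrite !in_itv/= => /andP[? ?]; rewrite !ltW.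
  have : 0 <= a^-1 by rewrite invr_ge0 ltW.
  rewrite /K; lra.
(* A uniform bound away from 0, and not merely [w x != 0], keeps [x / w] Lipschitz. *)
have [m m0 wm] : exists2 m, 0 < m & {in `[a, b], forall x, m <= `|w x|}.
  have r0 : 0 < expR (2 * K * (a - b)) by exact: expR_gt0.
  exists (Num.sqrt (expR (2 * K * (a - b)))); first by rewrite sqrtr_gt0.
  move=> x xab; rewrite -[leRHS]sqrtr_sqr ler_sqrt ?sqr_ge0//.
  have := w2 _ xab; rewrite mulrBr expRD -expr2.
  have e0 : 0 < expR (2 * K * x) by exact: expR_gt0.
  rewrite -ler_pdivrMl// => /(le_trans _); apply.
  rewrite mulrC ler_wpM2r ?expR_ge0// -expRN ler_expR lerN2.
  apply: ler_wpM2l; first by rewrite mulr_ge0.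
  by move: xab; rewrite in_itv/= => /andP[].
have wn0 x : x \in `[a, b] -> w x != 0.
  by move=> xab; rewrite -normr_gt0 (lt_le_trans m0)// wm.
pose f x := x * (w x)^-1 + - (lambda / 2 * (x * x)).
have lf x : x \in `[a, b] -> lip_on f a x.
  rewrite in_itv/= => /andP[ax xb].
  apply: (@lip_on_subset _ _ a b) => //.
  apply: lip_onD; first by apply: lip_onM; [exact: lip_on_id | exact: lip_onV m0 wm lw].
  apply: lip_onN; apply: lip_onM; first exact: lip_on_cst.
  by apply: lip_onM; exact: lip_on_id.
have df : {ae lebesgue_measure, forall x : R, x \in `]a, b[ ->
     is_derive x 1 f 0}.
  apply: ae_lebesgueS ode => y h yab; have dw := h yab.
  have wy : w y != 0.
    by apply: wn0; move: yab; rewrite !in_itv/= => /andP[? ?]; rewrite !ltW.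
  have y0 : y != 0.
    by move: yab; rewrite in_itv/= => /andP[ay _]; rewrite gt_eqF// (lt_trans a0).
  have d := is_derive1D
    (is_derive1M (is_derive_id y (1 : R)) (is_derive1_inv wy dw))
    (is_derive1N (is_derive1M (is_derive_cst (lambda / 2) y (1 : R))
      (is_derive1M (is_derive_id y (1 : R)) (is_derive_id y (1 : R))))).
  apply: (is_derive_eq d) => /=.
  by field; rewrite wy y0.
have fE x : x \in `[a, b] -> f x = f a.
  move=> xab; have := xab; rewrite in_itv/= => /andP[ax xb].
  have h1 : f a <= f x.
    apply: (@ae_derive_ge0_le _ f) => //; first exact: lf.
    apply: ae_lebesgueS df => y h yax; exists 0 => //; apply: h.
    exact: inab xab yax.
  have h2 : - f a <= - f x.
    apply: (@ae_derive_ge0_le _ (fun x => - f x)) => //.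
      exact/lip_onN/lf.
    apply: ae_lebesgueS df => y h yax; exists (- 0); last by rewrite oppr0.
    by apply: is_derive1N; apply: h; exact: inab xab yax.
  by apply/eqP; rewrite eq_le h1 andbT; rewrite lerN2 in h2.
have ab0 : a + b != 0 by lra.
have lamE : lambda = 2 / (a + b).
  have := fE b; rewrite in_itv/= lexx ltW// => /(_ isT).
  rewrite /f wa wb !invr1 => h.
  have {}h : (b - a) * (lambda * (a + b) - 2) = 0 by lra.
  have ba : b - a != 0 by lra.
  move/eqP: h; rewrite mulf_eq0 (negbTE ba)/= subr_eq0 => /eqP h.
  by rewrite -h mulfK.
move=> x xab; have := fE _ xab; rewrite /f wa lamE invr1 => h.
have x0 : 0 < x by move: xab; rewrite in_itv/= => /andP[? _]; lra.
have d0 : x ^+ 2 + a * b != 0.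
  by rewrite gt_eqF// addr_gt0 ?exprn_gt0 ?mulr_gt0//; lra.
have wx := wn0 _ xab.
have {}h : x * (w x)^-1 = (x ^+ 2 + a * b) / (a + b).
  have -> : x * (w x)^-1 = a * 1 - 2 / (a + b) / 2 * (a * a)
      + 2 / (a + b) / 2 * (x * x) by lra.
  by field.
have -> : w x = x / (x * (w x)^-1) by field; rewrite wx gt_eqF.
by rewrite h; field; rewrite ab0 d0.
Qed.

(** * Bounds on [lambda] and on the slopes of [w] *)

Section chord.
Context {R : realType}.
Variables (a b : R) (rho w : R -> R) (lambda : R).
Hypotheses (a_gt0 : 0 < a) (lw : lip_on w a b)
  (w_ge1 : {in `[a, b], forall x, 1 <= w x}) (ode : ae_ode a b rho w lambda).

(* With [u = 1 / w], [c = 1 / t] and the solution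
   [v x = c (x^2 + al be) / ((al + be) x)] of the problem for [rho = 0] that
   agrees with [u] at [al] and [be], the function [x exp (q x) (u - v)]
   vanishes at both ends, and its derivative is at least
   [x s + q c (x - al) (be - x) / (al + be)]
   where [s = lambda - 2 c / (al + be) - q c]. *)
Lemma chord_lambda (al be t q : R) : a <= al -> al < be -> be <= b ->
  w al = t -> w be = t -> 0 <= q -> {in `]al, be[, forall x, rho x <= q} ->
  0 <= lambda * t - 2 / (al + be) - q ->
  lambda * t - 2 / (al + be) - q <= 0 /\ q = 0.
Proof.
move=> aal albe beb wal wbe q0 rhoq s0.
have alab : al \in `[a, b] by rewrite in_itv/=; apply/andP; split; lra.
have t1 : 1 <= t by rewrite -wal w_ge1.
have a0 := a_gt0; have ab0 : 0 < al + be by lra.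
have abn0 : al + be != 0 by rewrite gt_eqF.
have tn0 : t != 0 by lra.
pose c := t^-1; have c0 : 0 < c by rewrite invr_gt0; lra.
pose s := lambda - 2 * c / (al + be) - q * c.
have sE : s = (lambda * t - 2 / (al + be) - q) * c.
  by rewrite /s /c; field; rewrite abn0 tn0.
have {}s0 : 0 <= s by rewrite sE mulr_ge0// ltW.
pose k := q * c / (al + be).
have k0 : 0 <= k by rewrite /k !mulr_ge0 ?invr_ge0//; lra.
(* The first summand is the function described above. What is subtracted is an antiderivative of
   [x * s + k * ((x - al) * (be - x))], so that the lower bound on the derivative becomes
   monotonicity of [H]. *)
pose H x := expR (q * x) * (x * (w x)^-1 +
   - (c / (al + be) * (x * x + al * be))) +
   - (s / 2 * (x * x) + k * (x * x * ((- 3^-1) * x + (al + be) / 2) +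
       - (al * be * x))).
have lH : lip_on H al be.
  have li := lip_on_id al be; have lc := lip_on_cst _ al be.
  apply: lip_onD.
    apply: lip_onM; first exact: lip_on_exp.
    apply: lip_onD.
      apply: lip_onM => //; apply: (@lip_onV _ _ _ _ 1) => //.
        move=> x; rewrite in_itv/= => /andP[? ?]; rewrite (le_trans _ (ler_norm _))//.
        by apply: w_ge1; rewrite in_itv/=; apply/andP; split; lra.
      by apply: lip_on_subset lw.
    by apply: lip_onN; apply: lip_onM => //; apply: lip_onD => //; apply: lip_onM.
  apply: lip_onN; apply: lip_onD.
    by apply: lip_onM => //; apply: lip_onM.
  apply: lip_onM => //; apply: lip_onD.
    apply: lip_onM; first by apply: lip_onM.
    by apply: lip_onD => //; apply: lip_onM.
  by apply: lip_onN; apply: lip_onM.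
have : H al <= H be.
  apply: (ae_derive_ge0_le (ltW albe) lH).
  apply: ae_lebesgueS ode => y h yalbe.
  have := yalbe; rewrite in_itv/= => /andP[aly ybe].
  have yab : y \in `]a, b[ by rewrite in_itv/=; apply/andP; split; lra.
  have dw := h yab.
  have wy : 1 <= w y by apply: w_ge1; rewrite in_itv/=; apply/andP; split; lra.
  have wy0 : w y != 0 by lra.
  have di := is_derive_id y (1 : R); have dc (r : R) := is_derive_cst r y (1 : R).
  have d := is_derive1D
    (is_derive1M (is_derive1_exp q y)
      (is_derive1D (is_derive1M di (is_derive1_inv wy0 dw))
        (is_derive1N (is_derive1M (dc (c / (al + be)))
          (is_derive1D (is_derive1M di di) (dc (al * be)))))))
    (is_derive1N (is_derive1D
      (is_derive1M (dc (s / 2)) (is_derive1M di di))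
      (is_derive1M (dc k) (is_derive1D
        (is_derive1M (is_derive1M di di)
          (is_derive1D (is_derive1M (dc (- 3^-1)) di) (dc ((al + be) / 2))))
        (is_derive1N (is_derive1M (dc (al * be)) di)))))).
  eexists; first exact: d.
  rewrite /=; set e := expR (q * y).
  (* The derivative carries the factor [e] on nonnegative terms; [1 <= e] allows dropping it, which
     leaves a polynomial with an explicit integral. *)
  have e1 : 1 <= e by rewrite -expR0 ler_expR mulr_ge0//; lra.
  have yp : 0 < y by lra.
  have qr : 0 <= y * (w y)^-1 * (q - rho y).
    have := rhoq _ yalbe => this.
    by clear - ode lw w_ge1 a_gt0 yp wy this; rewrite !mulr_ge0 ?invr_ge0//; lra.
  have ys : 0 <= y * s by rewrite mulr_ge0// ltW.
  have kp : 0 <= k * ((y - al) * (be - y)).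
    by clear - ode lw w_ge1 a_gt0 k0 aly ybe; rewrite mulr_ge0// mulr_ge0; lra.
  rewrite [leRHS](_ : _ = (e - 1) * (y * s + k * ((y - al) * (be - y))) +
    e * (y * (w y)^-1 * (q - rho y))); last first.
    rewrite /s /k /c.
    have yn0 : y != 0 by lra.
    by field; rewrite wy0 tn0 abn0 yn0.
  apply: addr_ge0; apply: mulr_ge0 => //.
  - by rewrite subr_ge0.
  - exact: addr_ge0.
  - exact: le_trans e1.
rewrite /H wal wbe => HH.
have e0 (z : R) : z = al \/ z = be ->
    z * t^-1 + - (c / (al + be) * (z * z + al * be)) = 0.
  by rewrite /c => -[] ->; field; rewrite abn0 tn0.
move: HH; rewrite (e0 al) ?(e0 be); [|by right|by left].
rewrite !mulr0 !add0r => HH.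
have d0 : 0 < be - al by lra.
have p1 : 0 <= s / 2 * ((be + al) * (be - al)).
  apply: mulr_ge0; [lra | apply: mulr_ge0; lra].
have p2 : 0 <= k * ((be - al) ^+ 3 / 6).
  by rewrite mulr_ge0// divr_ge0 ?exprn_ge0// ltW.
have {}HH : s / 2 * ((be + al) * (be - al)) + k * ((be - al) ^+ 3 / 6) <= 0.
  rewrite -subr_ge0 in HH; rewrite -oppr_ge0.
  rewrite [leRHS](_ : _ = - (s / 2 * (be * be) +
     k * (be * be * (- 3^-1 * be + (al + be) / 2) + - (al * be * be))) -
   - (s / 2 * (al * al) +
     k * (al * al * (- 3^-1 * al + (al + be) / 2) + - (al * be * al))))//.
  by field.
(* [H al <= H be] says that the integral of the lower bound over [[al, be]] is at most 0. Both of
   its terms are nonnegative, so [s] and [k] vanish, and with [k] also [q]. *)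
have s00 : s / 2 * ((be + al) * (be - al)) = 0 by lra.
have k00 : k * ((be - al) ^+ 3 / 6) = 0 by lra.
have P1 : 0 < 2^-1 * ((be + al) * (be - al)).
  by apply: mulr_gt0; [lra | apply: mulr_gt0; lra].
have P2 : 0 < (be - al) ^+ 3 / 6 by rewrite divr_gt0// exprn_gt0.
split.
  move/eqP: s00; rewrite -mulrA mulf_eq0 (gt_eqF P1) orbF sE.
  by rewrite mulf_eq0 (gt_eqF c0) orbF => /eqP ->.
move/eqP: k00; rewrite mulf_eq0 (gt_eqF P2) orbF.
by rewrite /k -mulrA mulf_eq0 (gt_eqF (divr_gt0 c0 ab0)) orbF => /eqP.
Qed.

(** Since [w] has a derivative only almost everywhere, its slope enters as a linear lower bound. The
    equation bounds [w'] by a continuous expression in which the constant [r] stands for [rho],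
    which may jump; the strict inequality at [al] persists nearby and makes [M * y - w y]
    nondecreasing there. *)
Lemma slope_left (al t r M : R) : a < al -> al < b -> w al = t ->
  {in `]a, al[, forall x, rho x <= r} -> t * (al^-1 + r - lambda * t) < M ->
  exists2 e, 0 < e &
    forall x, a <= x -> al - e < x -> x <= al -> t - M * (al - x) <= w x.
Proof.
move=> aal alb wal rhor tM.
have a0 := a_gt0; have cw : {for al, continuous w} by apply: lip_on_continuous lw.
have al0 : al != 0 by lra.
have cF : (fun x => w x * (x^-1 + r - lambda * w x)) x @[x --> al] -->
    t * (al^-1 + r - lambda * t).
  rewrite -wal; apply: cvgM; first exact: cw.
  apply: cvgB; last by apply: cvgM; [exact: cvg_cst | exact: cw].
  by apply: cvgD; [exact: inv_continuous | exact: cvg_cst].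
have : \forall x \near al, w x * (x^-1 + r - lambda * w x) < M.
  exact: cvgr_lt cF _ tM.
move=> /nbhs_ballP[e /= e0 eM]; exists e => // x ax ex xal.
have : M * x + - w x <= M * al + - w al.
  apply: (@ae_derive_ge0_le _ (fun y => M * y + - w y)) => //.
    apply: lip_onD.
      by apply: lip_onM; [exact: lip_on_cst | exact: lip_on_id].
    by apply: lip_onN; apply: lip_on_subset lw; lra.
  apply: ae_lebesgueS ode => y h yxal.
  have := yxal; rewrite in_itv/= => /andP[xy yal].
  have yab : y \in `]a, b[ by rewrite in_itv/=; apply/andP; split; lra.
  have dw := h yab.
  have wy : 1 <= w y by apply: w_ge1; rewrite in_itv/=; apply/andP; split; lra.
  eexists.
    exact: is_derive1D
      (is_derive1M (is_derive_cst M y (1 : R)) (is_derive_id y (1 : R)))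
      (is_derive1N dw).
  have yball : ball al e y by rewrite /ball/= ltr_distl; apply/andP; split; lra.
  have /= FM := eM _ yball.
  have : w y * rho y <= w y * r.
    apply: ler_wpM2l; first lra.
    by apply: rhor; rewrite in_itv/=; apply/andP; split; lra.
  rewrite /= mulr0 addr0 mulr1; lra.
rewrite wal; lra.
Qed.

Lemma slope_right (be t q M : R) : a < be -> be < b -> w be = t ->
  {in `]be, b[, forall x, q <= rho x} -> t * (lambda * t - be^-1 - q) < M ->
  exists2 e, 0 < e &
    forall x, x <= b -> x < be + e -> be <= x -> t - M * (x - be) <= w x.
Proof.
move=> abe beb wbe rhoq tM.
have a0 := a_gt0; have cw : {for be, continuous w} by apply: lip_on_continuous lw.
have be0 : be != 0 by lra.
have cF : (fun x => w x * (lambda * w x - x^-1 - q)) x @[x --> be] -->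
    t * (lambda * t - be^-1 - q).
  rewrite -wbe; apply: cvgM; first exact: cw.
  apply: cvgB; last exact: cvg_cst.
  apply: cvgB; last exact: inv_continuous.
  by apply: cvgM; [exact: cvg_cst | exact: cw].
have : \forall x \near be, w x * (lambda * w x - x^-1 - q) < M.
  exact: cvgr_lt cF _ tM.
move=> /nbhs_ballP[e /= e0 eM]; exists e => // x xb xe bex.
have : M * be + w be <= M * x + w x.
  apply: (@ae_derive_ge0_le _ (fun y => M * y + w y)) => //.
    apply: lip_onD.
      by apply: lip_onM; [exact: lip_on_cst | exact: lip_on_id].
    by apply: lip_on_subset lw; lra.
  apply: ae_lebesgueS ode => y h ybex.
  have := ybex; rewrite in_itv/= => /andP[bey yx].
  have yab : y \in `]a, b[ by rewrite in_itv/=; apply/andP; split; lra.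
  have dw := h yab.
  have wy : 1 <= w y by apply: w_ge1; rewrite in_itv/=; apply/andP; split; lra.
  eexists.
    exact: is_derive1D
      (is_derive1M (is_derive_cst M y (1 : R)) (is_derive_id y (1 : R))) dw.
  have yball : ball be e y by rewrite /ball/= ltr_distl; apply/andP; split; lra.
  have /= FM := eM _ yball.
  have : w y * q <= w y * rho y.
    apply: ler_wpM2l; first lra.
    by apply: rhoq; rewrite in_itv/=; apply/andP; split; lra.
  rewrite /= mulr0 addr0 mulr1; lra.
rewrite wbe; lra.
Qed.

End chord.

(** * Extent of the superlevel sets *)

Definition ratio_sq {R : realType} (x y : R) := (x + y) ^+ 2 / (x * y).

Lemma ratio_sq_le (R : realType) (x y x' y' : R) :
  0 < x' -> x' <= x -> x <= y -> y <= y' -> ratio_sq x y <= ratio_sq x' y'.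
Proof.
move=> x'0 x'x xy yy'.
have x0 : 0 < x by lra.
have y0 : 0 < y by lra.
have y'0 : 0 < y' by lra.
rewrite /ratio_sq ler_pdivlMr ?mulr_gt0// mulrAC ler_pdivrMr ?mulr_gt0//.
rewrite -subr_ge0 (_ : _ - _ = (y' * x - y * x') * (y' * y - x' * x)); last by ring.
by apply: mulr_ge0; rewrite subr_ge0 ler_pM//; lra.
Qed.

Lemma ratio_sq_gt0 (R : realType) (x y : R) : 0 < x -> 0 < y -> 0 < ratio_sq x y.
Proof. by move=> x0 y0; rewrite divr_gt0 ?exprn_gt0 ?mulr_gt0 ?addr_gt0. Qed.

(** [A] and [B] will be bounds on logarithmic slopes and may be negative or zero, where the speeds
    [al / A] and [be / B] make no sense. In that case one such slope is replaced by [th / 4], which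
    alone contributes 4, and the other by a larger positive number. Two positive slopes are raised
    by a quarter of the slack each, which keeps their sum below [2 * th], and the inequality of the
    means applies. *)
Lemma harmonic_slack (R : realType) (A B th : R) : 0 < th -> A + B < 2 * th ->
  exists A' B', [/\ A < A', B < B', 0 < A', 0 < B' &
    2 < th * (A'^-1 + B'^-1)].
Proof.
move=> th0 ABth.
have big (B' : R) : 0 < B' -> 2 < th * ((th / 4)^-1 + B'^-1).
  move=> B'0; have -> : th * ((th / 4)^-1 + B'^-1) = 4 + th * B'^-1.
    by field; rewrite !gt_eqF.
  by have := mulr_gt0 th0 (_ : 0 < B'^-1); rewrite invr_gt0 => /(_ B'0); lra.
have maxp (x : R) : x < Num.max x 0 + 1 /\ 0 < Num.max x 0 + 1.
  have : x <= Num.max x 0 by rewrite le_max lexx.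
  have : 0 <= Num.max x 0 by rewrite le_max lexx orbT.
  by lra.
have [A0|A0] := leP A 0.
  have [B1 B2] := maxp B.
  by exists (th / 4), (Num.max B 0 + 1); split => //; [lra | lra | exact: big].
have [B0|B0] := leP B 0.
  have [A1 A2] := maxp A.
  exists (Num.max A 0 + 1), (th / 4); split => //; [lra | lra |].
  by rewrite addrC; exact: big.
pose e := (2 * th - A - B) / 4.
exists (A + e), (B + e); have e0 : 0 < e by rewrite /e; lra.
split; try lra.
have AB' : 0 < (A + e) + (B + e) by lra.
apply: (@lt_le_trans _ _ (th * (4 / ((A + e) + (B + e))))).
  rewrite mulrA ltr_pdivlMr//; rewrite /e; lra.
rewrite ler_pM2l// -subr_ge0.
rewrite (_ : _ - _ = ((A + e) - (B + e)) ^+ 2 /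
    ((A + e) * (B + e) * ((A + e) + (B + e)))); last first.
  by field; rewrite !gt_eqF//; lra.
by rewrite divr_ge0 ?sqr_ge0 ?mulr_ge0//; lra.
Qed.

Lemma is_derive_gt0_right (R : realType) (f : R -> R) (l : R) :
  is_derive (0 : R) 1 f l -> f 0 = 0 -> 0 < l ->
  exists2 e, 0 < e & forall s, 0 < s -> s < e -> 0 < f s.
Proof.
move=> df f0 l0.
have dcvg : h^-1 *: (f (h + 0) - f 0) @[h --> 0^'] --> l.
  rewrite -(@derive_val _ _ _ _ _ _ _ df).
  have := @ex_derive _ _ _ _ _ _ _ df; rewrite /derivable /derive.
  rewrite (_ : (fun h : R => h^-1 *: (f (h *: 1 + 0) - f 0)) =
    (fun h : R => h^-1 *: (f (h + 0) - f 0)))//.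
  by apply/funext => h /=; rewrite [h *: 1]mulr1.
have : \forall h \near 0^', 0 < h^-1 *: (f (h + 0) - f 0).
  exact: cvgr_gt dcvg _ l0.
rewrite near_withinE => /nbhs_ballP[r /= r0 rP].
exists r => // s s0 sr.
have sball : ball 0 r s by rewrite /ball/= sub0r normrN gtr0_norm.
have /= := rP _ sball (lt0r_neq0 s0).
by rewrite addr0 f0 subr0 pmulr_rgt0// invr_gt0.
Qed.

(** The derivatives of [ln (ratio_sq x y)] in [ln y] and [ln x] are [(y - x) / (x + y)] and its
    opposite. So the last hypothesis says that the logarithm of the right-hand side has a positive
    derivative at [s = 0]. *)
Lemma ratio_sq_step (R : realType) (al be t eta P N : R) :
  0 < al -> al < be -> 0 < t -> 0 <= eta -> 0 < P -> 0 < N ->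
  2 * t < (t + eta) * ((be - al) / (be + al)) * (P + N) ->
  exists2 e, 0 < e & forall s, 0 < s -> s < e ->
    (t + eta) ^+ 2 * ratio_sq al be <
    (t * (1 - s) + eta) ^+ 2 * ratio_sq (al * (1 - s * P)) (be * (1 + s * N)).
Proof.
move=> al0 albe t0 eta0 P0 N0 tPN.
pose u s := (t + eta) + (- t) * s.
pose v s := (al + be) + (be * N - al * P) * s.
pose p s := (1 + (- P) * s) * (1 + N * s).
pose K := (t + eta) * (t + eta) * ((al + be) * (al + be)).
(* The difference of both sides with denominators cleared, up to the factor [al * be]: a polynomial
   vanishing at 0. *)
pose h s := (u s * u s) * (v s * v s) + (- K) * p s.
have di := is_derive_id (0 : R) (1 : R).
have dc (r : R) := is_derive_cst r (0 : R) (1 : R).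
have dl (r m : R) := is_derive1D (dc r) (is_derive1M (dc m) di).
have du := dl (t + eta) (- t); have dv := dl (al + be) (be * N - al * P).
have dh := is_derive1D
  (is_derive1M (is_derive1M du du) (is_derive1M dv dv))
  (is_derive1M (dc (- K)) (is_derive1M (dl 1 (- P)) (dl 1 N))).
have h0 : h 0 = 0 by rewrite /h /u /v /p /K; ring.
have [|e e0 he] := is_derive_gt0_right (f := h) dh h0.
  rewrite /= [ltRHS](_ : _ = (t + eta) * (al + be) ^+ 2 *
    ((t + eta) * ((be - al) / (be + al)) * (P + N) - 2 * t)); last first.
    by rewrite /K; field; rewrite gt_eqF//; lra.
  apply: mulr_gt0; last lra.
  by apply: mulr_gt0; [lra | apply: exprn_gt0; lra].
(* [s < P^-1] keeps the left end positive. *)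
exists (Num.min e P^-1); first by rewrite lt_min e0 invr_gt0.
move=> s s0; rewrite lt_min => /andP[se sP].
have sP1 : s * P < 1 by rewrite -ltr_pdivlMr// mul1r.
have x0 : 0 < al * (1 - s * P) by apply: mulr_gt0; lra.
have sN0 : 0 < s * N by apply: mulr_gt0.
have y0 : 0 < be * (1 + s * N) by apply: mulr_gt0; lra.
have be0 : 0 < be by lra.
rewrite /ratio_sq [ltLHS]mulrA [ltRHS]mulrA ltr_pdivlMr; last exact: mulr_gt0.
rewrite mulrAC ltr_pdivrMr ?mulr_gt0// -subr_gt0.
rewrite [ltRHS](_ : _ = al * be * h s).
  by rewrite !mulr_gt0// he.
by rewrite /h /u /v /p /K; ring.
Qed.

Lemma first_superlevel (R : realType) (w : R -> R) (a b x0 t : R) :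
  lip_on w a b -> a <= x0 -> x0 <= b -> t <= w x0 ->
  exists al, [/\ a <= al, al <= x0, t <= w al,
    {in `[a, b], forall x, t <= w x -> al <= x} & a < al -> w al = t].
Proof.
move=> [K K0 wK] ax0 x0b tw0.
pose A := [set x | [/\ a <= x, x <= b & t <= w x]].
have infA : has_inf A by split; [exists x0 | exists a => x []].
have aal : a <= inf A by apply: lb_le_inf; [exists x0 | move=> x []].
have alx0 : inf A <= x0 by apply: ge_inf => //; case: infA.
have inab x : a <= x -> x <= b -> x \in `[a, b].
  by move=> ? ?; rewrite in_itv/=; apply/andP.
have alA x : x \in `[a, b] -> t <= w x -> inf A <= x.
  rewrite in_itv/= => /andP[? ?] ?; apply: ge_inf; first by case: infA.
  by split.
have K1 : 0 < K + 1 by lra.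
have wal : t <= w (inf A).
  apply/ler_addgt0Pr => e e0.
  have [x [ax xb tx] xe] := inf_adherent (divr_gt0 e0 K1) infA.
  have alx : inf A <= x by apply: alA => //; exact: inab.
  have := wK _ _ (inab _ ax xb) (inab _ aal (le_trans alx0 x0b)).
  rewrite (ger0_norm (_ : 0 <= x - inf A)) ?subr_ge0//.
  have : K * (x - inf A) <= e.
    apply: (@le_trans _ _ ((K + 1) * (x - inf A))).
      by apply: ler_wpM2r; lra.
    by rewrite -ler_pdivlMl// mulrC; lra.
  by rewrite ler_norml => ? /andP[]; lra.
exists (inf A); split => // altb.
apply/eqP; rewrite eq_le wal andbT; apply/ler_addgt0Pr => e e0.
pose d := Num.min (e / (K + 1)) (inf A - a).
have d0 : 0 < d by rewrite lt_min divr_gt0//= subr_gt0.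
have de : d <= e / (K + 1) by rewrite ge_min lexx.
have da : d <= inf A - a by rewrite ge_min lexx orbT.
have xab : inf A - d \in `[a, b] by apply: inab; lra.
have wx : w (inf A - d) < t.
  by rewrite ltNge; apply/negP => /(alA _ xab); lra.
have := wK _ _ (inab _ aal (le_trans alx0 x0b)) xab.
rewrite (_ : inf A - (inf A - d) = d) ?(gtr0_norm d0); last by ring.
have : K * d <= e.
  apply: (@le_trans _ _ ((K + 1) * d)); first by apply: ler_wpM2r; lra.
  by rewrite -ler_pdivlMl// mulrC.
by rewrite ler_norml => ? /andP[]; lra.
Qed.

Lemma last_superlevel (R : realType) (w : R -> R) (a b x0 t : R) :
  lip_on w a b -> a <= x0 -> x0 <= b -> t <= w x0 ->
  exists be, [/\ be <= b, x0 <= be, t <= w be,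
    {in `[a, b], forall x, t <= w x -> x <= be} & be < b -> w be = t].
Proof.
move=> [K K0 wK] ax0 x0b tw0.
have lw' : lip_on (fun x => w (- x)) (- b) (- a).
  exists K => // x y; rewrite !in_itv/= => /andP[? ?] /andP[? ?].
  rewrite (_ : `|x - y| = `|- x - - y|).
    by apply: wK; rewrite in_itv/=; apply/andP; split; lra.
  by rewrite -normrN; congr (`|_|); ring.
have [||| al [bal alx wal alP ale]] :=
  @first_superlevel _ (fun x => w (- x)) (- b) (- a) (- x0) t lw'.
- by rewrite lerN2.
- by rewrite lerN2.
- by rewrite opprK.
exists (- al); split => //; [lra | lra | | by move=> ?; apply: ale; lra].
move=> x xab tx; suff : al <= - x by lra.
apply: alP; last by rewrite opprK.
by move: xab; rewrite !in_itv/= => /andP[? ?]; apply/andP; split; lra.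
Qed.

Section superlevel.
Context {R : realType}.
Variables (a b : R) (rho w : R -> R) (lambda : R).
Hypotheses (a_gt0 : 0 < a)
  (rho_ge0 : {in `[a, b], forall x, 0 <= rho x})
  (rho_nd : {in `[a, b] &, {homo rho : x y / x <= y}})
  (lw : lip_on w a b) (ode : ae_ode a b rho w lambda) (wa : w a = 1) (wb : w b = 1)
  (w_ge1 : {in `[a, b], forall x, 1 <= w x}).

(* [t A / al] and [t B / be] bound the slopes of [w] at [al] and [be], and
   [chord_lambda] bounds [A + B]; moving the end points outwards at speeds
   [al / A] and [be / B] lowers [w] by [t] per unit of time. *)
Lemma outward_step (eta al be t : R) : a < al -> al < be -> be < b ->
  w al = t -> w be = t -> 1 < t -> 0 <= eta -> (0 < eta) || (0 < rho be) ->
  exists t' x y, [/\ 1 <= t' < t, a <= x, x < y, y <= b &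
    [/\ t' <= w x, t' <= w y &
      (t + eta) ^+ 2 * ratio_sq al be < (t' + eta) ^+ 2 * ratio_sq x y]].
Proof.
have a0 := a_gt0; move=> aal albe beb wal wbe t1 eta0 slack.
have inab x : a <= x -> x <= b -> x \in `[a, b].
  by move=> ? ?; rewrite in_itv/=; apply/andP.
have alab : al \in `[a, b] by apply: inab; lra.
have beab : be \in `[a, b] by apply: inab; lra.
have q0 : 0 <= rho be by apply: rho_ge0.
have rq : rho al <= rho be by apply: rho_nd => //; lra.
have := @chord_lambda _ a b rho w lambda a_gt0 lw w_ge1 ode al be t (rho be)
  (ltW aal) albe (ltW beb) wal wbe q0.
set D := lambda * t - _ - _.
have rhobe : {in `]al, be[, forall x, rho x <= rho be}.
  move=> x; rewrite in_itv/= => /andP[? ?]; apply: rho_nd => //; last exact: ltW.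
  by apply: inab; lra.
move=> /(_ rhobe) Dlt.
(* The conditional form of [chord_lambda] is read twice: [D > 0] is impossible, and so is [D = 0]
   once [rho be] is positive. *)
have D0 : D <= 0.
  by rewrite leNgt; apply/negP => h; have [D0 _] := Dlt (ltW h); lra.
have Ds : 0 < rho be -> D < 0.
  by move=> q1; rewrite ltNge; apply/negP => /Dlt[_ q00]; lra.
have al0 : 0 < al by lra.
have be0 : 0 < be by lra.
have t0 : 0 < t by lra.
pose A := 1 + al * rho al - al * lambda * t.
pose B := be * lambda * t - 1 - be * rho be.
pose th := (be - al) / (be + al).
have th0 : 0 < th by rewrite divr_gt0; lra.
(* The last two terms are nonpositive, by [D <= 0] and by monotonicity of [rho]; [th] is the
   logarithmic derivative of [ratio_sq] in its second argument. *)
have ABE : A + B = 2 * th + (be - al) * D - al * (rho be - rho al).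
  by rewrite /A /B /th /D; field; rewrite gt_eqF//; lra.
(* The threshold of [ratio_sq_step] divided by [t]. It exceeds [th] as soon as [eta > 0], which then
   plays the part of [D < 0]. *)
pose th' := th * (t + eta) / t.
have th'0 : 0 < th' by rewrite divr_gt0// mulr_gt0//; lra.
have th'E : th' = th + th * eta / t by rewrite /th'; field; rewrite gt_eqF.
have ab0 : 0 <= al * (rho be - rho al) by apply: mulr_ge0; lra.
have thth' : 0 <= th * eta / t
  by apply: divr_ge0; [apply: mulr_ge0 => //; exact: ltW | exact: ltW].
have ABlt : A + B < 2 * th'.
  case/orP: slack => [eta1|q1].
    have : 0 < th * eta / t by apply: divr_gt0 => //; exact: mulr_gt0.
    have : (be - al) * D <= 0 by apply: mulr_ge0_le0; lra.
    lra.
  have : (be - al) * D < 0 by rewrite pmulr_rlt0; [exact: Ds | lra].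
  lra.
have [A' [B' [AA' BB' A'0 B'0 AB']]] := harmonic_slack th'0 ABlt.
have Ai0 : 0 < A'^-1 by rewrite invr_gt0.
have Bi0 : 0 < B'^-1 by rewrite invr_gt0.
have [|e1 e1_gt0 step] :=
  @ratio_sq_step _ al be t eta A'^-1 B'^-1 al0 albe t0 eta0 Ai0 Bi0.
  rewrite -/th; have : 2 * t < th' * (A'^-1 + B'^-1) * t by rewrite ltr_pM2r.
  by congr (_ < _); rewrite /th'; field; rewrite !gt_eqF.
have [||e2 e2_gt0 left] := @slope_left _ a b rho w lambda a_gt0 lw w_ge1 ode
    al t (rho al) (t * A' / al) aal (lt_trans albe beb) wal.
- move=> x; rewrite in_itv/= => /andP[? ?]; apply: rho_nd => //; last exact: ltW.
  by apply: inab; lra.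
- rewrite ltr_pdivlMr// (_ : _ * al = t * A) ?ltr_pM2l//.
  by rewrite /A; field; rewrite gt_eqF.
have [||e3 e3_gt0 right] := @slope_right _ a b rho w lambda a_gt0 lw w_ge1 ode
    be t (rho be) (t * B' / be) (lt_trans aal albe) beb wbe.
- move=> x; rewrite in_itv/= => /andP[? ?]; apply: rho_nd => //; last exact: ltW.
  by apply: inab; lra.
- rewrite ltr_pdivlMr// (_ : _ * be = t * B) ?ltr_pM2l//.
  by rewrite /B; field; rewrite gt_eqF.
(* In this order: the range of the ratio gain, level at least 1, both ends within [[a, b]], the
   ranges of the two slope bounds. *)
pose m := Num.min e1 (Num.min ((t - 1) / t) (Num.min ((al - a) / al * A')
  (Num.min ((b - be) / be * B') (Num.min (e2 / al * A') (e3 / be * B'))))).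
have m0 : 0 < m.
  rewrite !lt_min e1_gt0 !mulr_gt0 ?invr_gt0 ?subr_gt0//.
have : m / 2 < m by lra.
rewrite {2}/m !lt_min => /and5P[s1 s2 s3 s4 /andP[s5 s6]].
set s := m / 2 in s1 s2 s3 s4 s5 s6; have s0 : 0 < s by rewrite /s; lra.
have {}s2 : t * s < t - 1 by rewrite mulrC -ltr_pdivlMr.
have trl (c : R) : s < c / al * A' -> al * (s * A'^-1) < c.
  by rewrite -ltr_pdivrMr// ltr_pdivlMr// mulrC.
have trr (c : R) : s < c / be * B' -> be * (s * B'^-1) < c.
  by rewrite -ltr_pdivrMr// ltr_pdivlMr// mulrC.
move/trl: s3 => s3; move/trl: s5 => s5; move/trr: s4 => s4; move/trr: s6 => s6.
have ts0 : 0 < t * s by rewrite mulr_gt0.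
have x0 : 0 < al * (s * A'^-1) by rewrite !mulr_gt0.
have y0 : 0 < be * (s * B'^-1) by rewrite !mulr_gt0.
set X := al * (s * A'^-1) in s3 s5 x0; set Y := be * (s * B'^-1) in s4 s6 y0.
have xE : al * (1 - s * A'^-1) = al - X by rewrite mulrBr mulr1.
have yE : be * (1 + s * B'^-1) = be + Y by rewrite mulrDr mulr1.
have t'E : t * (1 - s) = t - t * s by rewrite mulrBr mulr1.
exists (t * (1 - s)), (al * (1 - s * A'^-1)), (be * (1 + s * B'^-1)).
split; [| | | |split; last exact: step]; rewrite ?xE ?yE ?t'E.
- by clear - rho_ge0 rho_nd ode lw wa wb w_ge1 a_gt0 s2 ts0; apply/andP; split; lra.
- by clear - rho_ge0 rho_nd ode lw wa wb w_ge1 a_gt0 s3; lra.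
- by clear - rho_ge0 rho_nd ode lw wa wb w_ge1 a_gt0 x0 y0 albe; lra.
- by clear - rho_ge0 rho_nd ode lw wa wb w_ge1 a_gt0 s4; lra.
- rewrite (_ : t * s = t * A' / al * (al - (al - X))); last first.
    by rewrite /X; field; rewrite !gt_eqF.
  by apply: left; clear - rho_ge0 rho_nd ode lw wa wb w_ge1 a_gt0 s3 s5 x0; lra.
- rewrite (_ : t * s = t * B' / be * (be + Y - be)); last first.
    by rewrite /Y; field; rewrite !gt_eqF.
  by apply: right; clear - rho_ge0 rho_nd ode lw wa wb w_ge1 a_gt0 s4 s6 y0; lra.
Qed.

(** For fixed [eta], consider all levels that carry a pair of points with at least the initial value
    [G]. Their infimum is again such a level: its hull contains the pairs of all higher levels, and
    [ratio_sq] grows with the interval. Above 1 an outward step would lead below the infimum; at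
    level 1 the hull lies in [[a, b]]. *)
Lemma superlevel_ratio_le (T x1 x2 : R) : a <= x1 -> x1 < x2 -> x2 <= b ->
  1 <= T -> T <= w x1 -> T <= w x2 ->
  T ^+ 2 * ratio_sq x1 x2 <= ratio_sq a b.
Proof.
have a0 := a_gt0; move=> ax1 x12 x2b T1 Tx1 Tx2.
have inab x : a <= x -> x <= b -> x \in `[a, b].
  by move=> ? ?; rewrite in_itv/=; apply/andP.
have eta_main eta : 0 < eta ->
    (T + eta) ^+ 2 * ratio_sq x1 x2 <= (1 + eta) ^+ 2 * ratio_sq a b.
  move=> eta0; set G := (X in X <= _).
  pose S := [set t | [/\ 1 <= t, t <= T & exists x y, [/\ a <= x, x < y, y <= b &
     [/\ t <= w x, t <= w y & G <= (t + eta) ^+ 2 * ratio_sq x y]]]].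
  have ST : S T by split => //; exists x1, x2.
  have infS : has_inf S by split; [exists T | exists 1 => t []].
  have lbS := ge_inf infS.2.
  have ts1 : 1 <= inf S by apply: lb_le_inf; [exists T | move=> t []].
  have tsT : inf S <= T by exact: lbS.
  set ts := inf S in ts1 tsT lbS.
  have [|||al [aal alx1 wal alP altE]] := @first_superlevel _ w a b x1 ts lw => //.
  - lra.
  - lra.
  have [|||be [beb x2be wbe beP betE]] := @last_superlevel _ w a b x2 ts lw => //.
  - lra.
  - lra.
  have Q0 : 0 < ratio_sq al be by apply: ratio_sq_gt0; lra.
  have Gts : G <= (ts + eta) ^+ 2 * ratio_sq al be.
    apply/ler_addgt0Pr => e e0.
    (* For [0 <= d <= 1], [(ts + d + eta)^2 <= (ts + eta)^2 + d * (2 * (ts + eta) + 1)]. *)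
    pose M := (2 * (ts + eta) + 1) * ratio_sq al be.
    have M0 : 0 < M by rewrite mulr_gt0//; lra.
    pose d := Num.min 1 (e / M).
    have d0 : 0 < d by rewrite lt_min ltr01 divr_gt0.
    have d1 : d <= 1 by rewrite ge_min lexx.
    have dM : d * M <= e by rewrite -ler_pdivlMr// ge_min lexx orbT.
    have [t [t1 tT [x [y [ax xy yb [tx ty Gt]]]]] td] := inf_adherent d0 infS.
    have tst : ts <= t by apply: lbS; split => //; exists x, y.
    have alx : al <= x.
      by clear - rho_ge0 rho_nd ode lw wa wb w_ge1 a_gt0
          alP inab ax xy yb tst tx; apply: alP; [apply: inab; lra | lra].
    have ybe : y <= be.
      by clear - rho_ge0 rho_nd ode lw wa wb w_ge1 a_gt0
          beP inab ax xy yb tst ty; apply: beP; [apply: inab; lra | lra].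
    have Qxy : ratio_sq x y <= ratio_sq al be.
      by clear - rho_ge0 rho_nd ode lw wa wb w_ge1 a_gt0
          a0 aal alx xy ybe; apply: ratio_sq_le; lra.
    rewrite (le_trans Gt)//.
    apply: (@le_trans _ _ ((ts + d + eta) ^+ 2 * ratio_sq al be)).
      apply: ler_pM => //; first exact: sqr_ge0.
        by clear - rho_ge0 rho_nd ode lw wa wb w_ge1 a_gt0
            a0 ax xy; apply/ltW/ratio_sq_gt0; lra.
      by clear - rho_ge0 rho_nd ode lw wa wb w_ge1 a_gt0
          t1 ts1 d0 eta0 td; rewrite lerXn2r ?nnegrE//; lra.
    have : d * (d * ratio_sq al be) <= d * ratio_sq al be.
      by apply: ler_piMl => //; rewrite mulr_ge0// ltW.
    move: dM; rewrite /M; lra.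
  have [ts_gt1|ts_le1] := ltP 1 ts; last first.
    have tsE : ts = 1 by clear - rho_ge0 rho_nd ode lw wa wb w_ge1 a_gt0
        ts1 ts_le1; lra.
    rewrite tsE in Gts; rewrite (le_trans Gts)// ler_wpM2l ?sqr_ge0//.
    by clear - rho_ge0 rho_nd ode lw wa wb w_ge1 a_gt0
        a0 aal alx1 x12 x2be beb; apply: ratio_sq_le; lra.
  have aal' : a < al.
    by rewrite lt_neqAle aal andbT; apply/eqP => aE; move: wal; rewrite -aE wa; lra.
  have beb' : be < b.
    by rewrite lt_neqAle beb andbT; apply/eqP => bE; move: wbe; rewrite bE wb; lra.
  have albe : al < be by lra.
  have eta_slack : (0 < eta) || (0 < rho be) by rewrite eta0.
  have [t' [x [y [/andP[t'1 t'ts] ax xy yb [tx ty Qlt]]]]] :=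
    outward_step aal' albe beb' (altE aal') (betE beb') ts_gt1 (ltW eta0) eta_slack.
  have : ts <= t'.
    apply: lbS; split => //; first lra.
    by exists x, y; split => //; split => //; lra.
  lra.
apply/ler_addgt0Pr => e e0.
have Q0 : 0 < ratio_sq a b by apply: ratio_sq_gt0; lra.
(* The 3 comes from [(1 + eta)^2 <= 1 + 3 * eta] for [0 <= eta <= 1]. *)
pose eta := Num.min 1 (e / (3 * ratio_sq a b)).
have q3 : 0 < 3 * ratio_sq a b by apply: mulr_gt0.
have h0 : 0 < eta by rewrite lt_min ltr01 divr_gt0.
have h1 : eta <= 1 by rewrite ge_min lexx.
have hM : eta * (3 * ratio_sq a b) <= e.
  by rewrite -ler_pdivlMr// ge_min lexx orbT.
have := eta_main _ h0.
have : T ^+ 2 * ratio_sq x1 x2 <= (T + eta) ^+ 2 * ratio_sq x1 x2.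
  apply: ler_wpM2r; first by apply/ltW/ratio_sq_gt0; lra.
  by clear - rho_ge0 rho_nd ode lw wa wb w_ge1 a_gt0
      T1 h0; rewrite lerXn2r ?nnegrE//; lra.
have : eta * (eta * ratio_sq a b) <= eta * ratio_sq a b.
  by apply: ler_piMl => //; rewrite mulr_ge0// ltW.
lra.
Qed.

(** The two points make the hull nondegenerate, and monotonicity carries [0 < rho x2] to its right
    end, which admits a step with [eta = 0]. *)
Lemma superlevel_ratio_lt (T x1 x2 : R) : a <= x1 -> x1 < x2 -> x2 <= b ->
  1 < T -> T <= w x1 -> T <= w x2 ->
  exists al be, [/\ a <= al, al < be, be <= b &
   [/\ {in `[a, b], forall x, T <= w x -> al <= x <= be},
       T ^+ 2 * ratio_sq al be <= ratio_sq a b &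
       0 < rho x2 -> T ^+ 2 * ratio_sq al be < ratio_sq a b]].
Proof.
have a0 := a_gt0; move=> ax1 x12 x2b T1 Tx1 Tx2.
have [|||al [aal alx1 wal alP altE]] := @first_superlevel _ w a b x1 T lw => //.
- lra.
have [|||be [beb x2be wbe beP betE]] := @last_superlevel _ w a b x2 T lw => //.
- lra.
have albe : al < be by lra.
have aal' : a < al.
  by rewrite lt_neqAle aal andbT; apply/eqP => aE; move: wal; rewrite -aE wa; lra.
have beb' : be < b.
  by rewrite lt_neqAle beb andbT; apply/eqP => bE; move: wbe; rewrite bE wb; lra.
exists al, be; split => //; split.
- by move=> x xab Tx; rewrite alP// beP.
- by apply: superlevel_ratio_le => //; lra.
move=> rx2.
have rbe : 0 < rho be.
  apply: lt_le_trans rx2 (rho_nd _ _ x2be); rewrite in_itv/=; apply/andP; split; lra.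
have slack : (0 < (0 : R)) || (0 < rho be) by rewrite rbe orbT.
have [t' [x [y [/andP[t'1 t'ts] ax xy yb [tx ty Qlt]]]]] :=
  outward_step aal' albe beb' (altE aal') (betE beb') T1 (lexx 0) slack.
rewrite !addr0 in Qlt.
by apply: (lt_le_trans Qlt); apply: superlevel_ratio_le.
Qed.

End superlevel.

(** * Densities and the layer cake formula *)

Section integral_density.
Local Open Scope ereal_scope.
Import HBNNSimple.
Context d (T : measurableType d) (R : realType).
Variables (mu nu : {measure set T -> \bar R}) (D : set T) (g : T -> R).
Hypotheses (mD : measurable D) (mg : measurable_fun D g)
  (g0 : forall x, D x -> (0 <= g x)%R)
  (nuE : forall A, measurable A -> A `<=` D -> nu A = \int[mu]_(x in A) (g x)%:E).

Let mgE : measurable_fun D (EFin \o g). Proof. exact/measurable_EFinP. Qed.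

Let integral_density_nnsfun (h : {nnsfun T >-> R}) :
  \int[nu]_(x in D) (h x)%:E = \int[mu]_(x in D) ((h x)%:E * (g x)%:E).
Proof.
have hE x : (h x)%:E = \sum_(y \in range h) (y * \1_(h @^-1` [set y]) x)%:E.
  by rewrite fimfunE -fsumEFin.
have mh y : measurable_fun D (fun x => (y * \1_(h @^-1` [set y]) x)%:E).
  by apply/measurable_funTS/measurable_EFinP; exact: measurable_funM.
under eq_integral do rewrite hE.
rewrite ge0_integral_fsum//; last by move=> *; exact: nnfun_muleindic_ge0.
under [RHS]eq_integral.
  move=> x xD; rewrite hE ge0_mule_fsuml; last by move=> *; exact: nnfun_muleindic_ge0.
  over.
rewrite ge0_integral_fsum//; last 2 first.
- by move=> y; exact: emeasurable_funM.
- by move=> y x Dx; rewrite mule_ge0 ?nnfun_muleindic_ge0// lee_fin g0.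
apply: eq_fsbigr => y /set_mem[z _ hz]; set A := h @^-1` [set y].
have mA : measurable A by exact: measurable_sfunP.
have y0 : (0 <= y)%R by rewrite -hz.
rewrite integralZl_indic_nnsfun// integral_indic// nuE; last 2 first.
- exact: measurableI.
- exact: subIsetr.
under [RHS]eq_integral do rewrite EFinM -muleA.
rewrite ge0_integralZl//; last 2 first.
- by apply: emeasurable_funM => //; apply/measurable_funTS/measurable_EFinP.
- by move=> x Dx; rewrite mule_ge0 ?lee_fin ?g0.
rewrite setIC integral_mkcondr; congr (_ * _); apply: eq_integral => x _.
by rewrite epatch_indic muleC.
Qed.

(** The density is assumed on measurable subsets of [D] only. This covers [invx_measure] on a set of
    positive reals and, with [g = 1], the passage from a measure to its restriction to [D]. *)
Lemma integral_density (f : T -> \bar R) : measurable_fun D f ->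
  (forall x, D x -> 0 <= f x) ->
  \int[nu]_(x in D) f x = \int[mu]_(x in D) (f x * (g x)%:E).
Proof.
move=> mf f0; pose h := nnsfun_approx mD mf.
have h_nd x : {homo (fun n => h n x) : m n / (m <= n)%N >-> (m <= n)%R}.
  by move=> m n mn; exact/lefP/nd_nnsfun_approx.
have hf x : D x -> (h n x)%:E @[n --> \oo] --> f x.
  by move=> Dx; exact: cvg_nnsfun_approx.
transitivity (limn (fun n => \int[nu]_(x in D) (h n x)%:E)).
  rewrite -monotone_convergence//.
  - by apply: eq_integral => x /set_mem Dx; apply/esym/cvg_lim => //; exact: hf.
  - by move=> n; apply/measurable_funTS/measurable_EFinP.
  - by move=> n x _; rewrite lee_fin.
  - by move=> x _ m n mn; rewrite lee_fin; exact: h_nd.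
under eq_fun do rewrite integral_density_nnsfun.
rewrite -monotone_convergence//.
- apply: eq_integral => x /set_mem Dx; apply/cvg_lim => //.
  by apply: cvgeZr => //; exact: hf.
- by move=> n; apply: emeasurable_funM => //; apply/measurable_funTS/measurable_EFinP.
- by move=> n x Dx; rewrite mule_ge0 ?lee_fin ?g0.
- by move=> x Dx m n mn; rewrite lee_wpmul2r ?lee_fin ?g0// h_nd.
Qed.

End integral_density.

Section layer_cake.
Local Open Scope ereal_scope.
Context d (T : measurableType d) (R : realType).
Variables (mu : {measure set T -> \bar R}) (D : set T).
Hypotheses (mD : measurable D) (muD : mu D < +oo).
Variable f : T -> R.
Hypotheses (mf : measurable_fun D f) (f0 : forall x, D x -> (0 <= f x)%R).

Let g := f \_ D.

Let mg : measurable_fun setT g.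
Proof. by apply/(measurable_restrictT _ _).1. Qed.

Let hypograph := [set z : T * measurableTypeR R | (0 <= z.2)%R && (z.2 < g z.1)%R].

Let measurable_hypograph : measurable hypograph.
Proof.
have h1 : measurable_fun setT (fun z : T * measurableTypeR R => (0 <= z.2)%R).
  by apply: measurable_fun_ler => //; exact: measurable_snd.
have h2 : measurable_fun setT (fun z : T * measurableTypeR R => (z.2 < g z.1)%R).
  by apply: measurable_fun_ltr; [exact: measurable_snd | exact: measurableT_comp].
have := measurableI _ _ (h1 measurableT [set true] I) (h2 measurableT [set true] I).
rewrite !setTI; congr measurable.
by apply/seteqP; split => [z [? ?]|z /andP[]]; [apply/andP|].
Qed.

Let gD x s : (0 <= s)%R -> (s < g x)%R -> D x /\ (s < f x)%R.
Proof.
move=> s0; rewrite /g patchE; case: ifPn => [/set_mem//|_ sl].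
by have := le_lt_trans s0 sl; rewrite ltxx.
Qed.

Let layerE s : (0 <= s)%R ->
  ysection hypograph s = D `&` [set x | (s < f x)%R].
Proof.
move=> s0; apply/seteqP; split => x; rewrite /ysection/= inE /hypograph/= s0/=.
  by move=> /(gD s0).
by move=> [Dx sf]; rewrite /g patchE mem_set.
Qed.

Lemma measurable_layer :
  measurable_fun (`[0%R, +oo[%classic : set (measurableTypeR R))
    (fun s => mu (D `&` [set x | (s < f x)%R])).
Proof.
apply: (eq_measurable_fun (fun s => mfrestr mD muD (ysection hypograph s))).
  move=> s; rewrite inE/= in_itv/= andbT => s0.
  by rewrite layerE// /mfrestr /mrestr setIAC setIid.
apply: measurable_funTS.
exact: (@measurable_fun_ysection _ _ _ _ _ (mfrestr mD muD)).
Qed.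

(** Tonelli for the indicator of the region under the graph. Restricting [mu] to [D] makes it
    finite, as Tonelli requires, and [g] vanishes off [D], so the region has no points there. *)
Lemma integral_layer_cake : \int[mu]_(x in D) (f x)%:E =
  \int[lebesgue_measure]_(s in `[0%R, +oo[) mu (D `&` [set x | (s < f x)%R]).
Proof.
transitivity (\int[mfrestr mD muD]_x (g x)%:E).
  transitivity (\int[mfrestr mD muD]_(x in D) (f x)%:E).
    rewrite (@integral_density _ _ _ mu (mfrestr mD muD) D (cst 1%R))//.
    + by apply: eq_integral => x _; rewrite mule1.
    + by move=> A mA AD; rewrite (integral_cst mu mA 1%:E) mul1e /=
        /mfrestr /mrestr setIidl.
    + exact/measurable_EFinP.
  by rewrite integral_mkcond restrict_EFin.
have := indic_fubini_tonelli (mfrestr mD muD) lebesgue_measure measurable_hypograph.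
rewrite /fubini_F /fubini_G => tonelli.
transitivity (\int[mfrestr mD muD]_x \int[lebesgue_measure]_s (\1_hypograph (x, s))%:E).
  apply: eq_integral => x _.
  have gx0 : (0 <= g x)%R.
    by rewrite /g patchE; case: ifPn => // /set_mem; exact: f0.
  rewrite (_ : (fun s => _) = (fun s => (\1_`[0%R, g x[ s)%:E)).
    rewrite integral_indic// setIT.
    rewrite [RHS](lebesgue_measure_itv `[0%R, g x[)/= lte_fin sube0.
    by case: ltP => // gx; apply/eqP; rewrite eqe eq_le gx gx0.
  by apply/funext => s; rewrite !indicE; congr (_%:R%:E); congr (nat_of_bool _);
    apply/idP/idP => /set_mem h; apply/mem_set; move: h; rewrite /= in_itv.
rewrite tonelli [RHS]integral_mkcond; apply: eq_integral => s _.
have [s0|s0] := boolP (0 <= s)%R; rewrite patchE.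
  rewrite mem_set/= ?in_itv/= ?andbT//.
  rewrite -layerE// (_ : (fun x => _) = (fun x => (\1_(ysection hypograph s) x)%:E)).
    rewrite integral_indic// ?setIT; last exact: measurable_ysection.
    by rewrite /= /mfrestr /mrestr layerE// setIAC setIid.
  by apply/funext => x; rewrite !indicE mem_ysection.
rewrite memNset/= ?in_itv/= ?andbT; last exact/negP.
apply: integral0_eq => x _; rewrite indicE memNset// /hypograph/=.
by move=> /andP[s0' _]; rewrite s0' in s0.
Qed.

End layer_cake.

Lemma FTC2_is_derive (R : realType) (F f : R -> R) (c d : R) : c <= d ->
  {in `[c, d], forall x : R, is_derive x 1 F (f x)} ->
  {in `[c, d], forall x, {for x, continuous f}} ->
  (\int[lebesgue_measure]_(x in `[c, d]) (f x)%:E = (F d - F c)%:E)%E.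
Proof.
move=> cd dF cf; move: cd; rewrite le_eqVlt => /predU1P[<-|cd].
  by rewrite set_itv1 integral_set1 subrr.
have inoo x : x \in `]c, d[ -> x \in `[c, d] by apply: subset_itv_oo_cc.
have cF x : x \in `[c, d] -> {for x, continuous F}.
  move=> /dF dFx; apply/differentiable_continuous/derivable1_diffP.
  exact: ex_derive.
rewrite (@continuous_FTC2 _ f F c d) ?EFinB//.
- by apply: continuous_in_subspaceT => x /set_mem; exact: cf.
- split.
  + by move=> x /inoo /dF dFx; exact: ex_derive.
  + by apply: cvg_at_right_filter; apply: cF; rewrite in_itv/= lexx ltW.
  + by apply: cvg_at_left_filter; apply: cF; rewrite in_itv/= lexx ltW.
- by move=> x /inoo /dF dFx; rewrite derive1E derive_val.
Qed.

(** * The measure [dx / x] on Borel sets *)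

Section invx_measure_theory.
Context {R : realType}.
Local Notation M := (invx_measure R).
Local Notation leb := (@lebesgue_measure R).

Lemma measurable_lebesgueTypeR (A : set R) :
  measurable (A : set (measurableTypeR R)) -> measurable (A : set (lebesgueTypeR R)).
Proof. by move=> mA; exact: sub_caratheodory. Qed.

Lemma measurable_fun_lebesgueTypeR (D : set R) (f : R -> R) :
  measurable (D : set (measurableTypeR R)) ->
  measurable_fun (D : set (measurableTypeR R)) f ->
  measurable_fun (D : set (lebesgueTypeR R)) f.
Proof.
move=> mD mf mD' B mB; apply: measurable_lebesgueTypeR; exact: mf.
Qed.

Let idb := (idfun : lebesgueTypeR R -> measurableTypeR R).

Let measurable_idb : measurable_fun setT idb.
Proof. by move=> _ A mA; rewrite setTI; exact: measurable_lebesgueTypeR. Qed.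

Let measurable_inv (D : set R) : measurable (D : set (measurableTypeR R)) ->
  D `<=` `]0%R, +oo[%classic ->
  measurable_fun (D : set (measurableTypeR R)) (fun x : R => x^-1).
Proof.
move=> mD D0.
apply: (@measurable_funS _ _ (measurableTypeR R) _ `]0%R, +oo[%classic) => //.
apply: open_continuous_measurable_fun => [|x]; first exact: interval_open.
rewrite inE /= in_itv/= andbT => x0.
by apply: inv_continuous; rewrite gt_eqF.
Qed.

(** The identity from the Lebesgue to the Borel sigma-algebra is measurable and pushes the completed
    measure forward to [lebesgue_measure]. *)
Let integral_completed (D : set R) (f : R -> R) :
  measurable (D : set (measurableTypeR R)) ->
  measurable_fun (D : set (measurableTypeR R)) f -> {in D, forall x, 0 <= f x} ->
  (\int[@completed_lebesgue_measure R]_(x in D) (f x)%:E =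
   \int[leb]_(x in D) (f x)%:E)%E.
Proof.
move=> mD mf f0.
transitivity (\int[pushforward (@completed_lebesgue_measure R) idb]_(x in D)
   (f x)%:E)%E; last by apply: eq_measure_integral.
rewrite ge0_integral_pushforward//; exact/measurable_EFinP.
Qed.

Lemma invx_measureE (A : set R) : measurable (A : set (measurableTypeR R)) ->
  A `<=` `]0%R, +oo[%classic ->
  M A = (\int[leb]_(x in A) (x^-1)%:E)%E.
Proof.
move=> mA A0; rewrite /invx_measure setIidl//.
apply: integral_completed => //; first exact: measurable_inv.
move=> x /set_mem /A0; rewrite /= in_itv/= andbT => x0.
by rewrite invr_ge0 ltW.
Qed.

Lemma integral_invx (D : set R) (f : R -> R) :
  measurable (D : set (measurableTypeR R)) -> D `<=` `]0%R, +oo[%classic ->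
  measurable_fun (D : set (measurableTypeR R)) f -> {in D, forall x, 0 <= f x} ->
  (\int[M]_(x in D) (f x)%:E = \int[leb]_(x in D) (f x * x^-1)%:E)%E.
Proof.
move=> mD D0 mf f0.
have Dinv x : D x -> 0 <= x^-1.
  by move=> /D0; rewrite /= in_itv/= andbT invr_ge0 => /ltW.
have mfi := measurable_inv mD D0.
rewrite (@integral_density _ _ _ (@completed_lebesgue_measure R) M D
  (fun x : R => x^-1)).
- rewrite -integral_completed//; first exact: measurable_funM.
  by move=> x xD; rewrite mulr_ge0 ?f0//; exact/Dinv/set_mem.
- exact: measurable_lebesgueTypeR.
- exact: measurable_fun_lebesgueTypeR.
- exact: Dinv.
- by move=> A mA AD; rewrite /= /invx_measure setIidl//; exact: subset_trans D0.
- by apply/measurable_EFinP; exact: measurable_fun_lebesgueTypeR.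
- by move=> x Dx; rewrite lee_fin f0// mem_set.
Qed.

Lemma invx_measure_itv (c d : R) : 0 < c -> c <= d ->
  M `[c, d]%classic = (ln d - ln c)%:E.
Proof.
move=> c0 cd.
have pos x : x \in `[c, d] -> 0 < x.
  by rewrite in_itv/= => /andP[cx _]; exact: lt_le_trans cx.
rewrite invx_measureE//; last by move=> x /pos; rewrite /= in_itv/= andbT.
rewrite (@FTC2_is_derive _ (@ln R))//.
- by move=> x /pos x0; exact: is_derive1_ln.
- by move=> x /pos x0; apply: inv_continuous; rewrite gt_eqF.
Qed.

Lemma invx_measure1 (x : R) : 0 < x -> M [set x] = 0%E.
Proof. by move=> x0; rewrite -set_itv1 invx_measure_itv// subrr. Qed.

Lemma invx_measure_itvoo_lty (a b : R) : 0 < a -> a < b -> (M `]a, b[%classic < +oo)%E.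
Proof.
move=> a0 ab; apply: (@le_lt_trans _ _ (M `[a, b]%classic)).
  by apply: le_measure; rewrite ?inE; try exact: measurable_lebesgueTypeR;
    exact: subset_itv_oo_cc.
by rewrite invx_measure_itv ?ltry// ltW.
Qed.

End invx_measure_theory.

(** * Comparison with the solution for [rho = 0] *)

Definition bvp0_sol {R : realType} (a b x : R) := (a + b) * x / (x ^+ 2 + a * b).

Section bvp0_sol_theory.
Context {R : realType}.
Variables (a b : R).
Hypotheses (a_gt0 : 0 < a) (a_lt_b : a < b).
Local Notation W0 := (bvp0_sol a b).

Let den_gt0 (x : R) : 0 < x ^+ 2 + a * b.
Proof.
by rewrite ltr_wpDl ?sqr_ge0// mulr_gt0//; apply: lt_trans a_lt_b.
Qed.

Lemma bvp0_sol_ge (t x : R) :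
  (t <= W0 x) = (t * (x ^+ 2 + a * b) <= (a + b) * x).
Proof. by rewrite /bvp0_sol ler_pdivlMr. Qed.

Lemma bvp0_sol_gt1 (x : R) : (1 < W0 x) = (x \in `]a, b[).
Proof.
rewrite /bvp0_sol ltr_pdivlMr// mul1r -subr_gt0.
rewrite (_ : _ - _ = (x - a) * (b - x)); last by ring.
rewrite in_itv/=; apply/idP/andP => [|[ax xb]]; last by rewrite mulr_gt0 ?subr_gt0.
have ab := a_lt_b => p; split; rewrite ltNge; apply/negP => h.
  have : (x - a) * (b - x) <= 0 by apply: mulr_le0_ge0; lra.
  lra.
have : (x - a) * (b - x) <= 0 by apply: mulr_ge0_le0; lra.
lra.
Qed.

Lemma continuous_bvp0_sol : continuous W0.
Proof.
move=> x; apply: cvgM.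
  by apply: cvgM; [exact: cvg_cst | exact: cvg_id].
apply: cvgV; first by rewrite gt_eqF.
apply: cvgD; last exact: cvg_cst.
exact: exprn_continuous.
Qed.

(** [t <= W0 x] is the quadratic inequality [t x^2 - (a + b) x + t a b <= 0], convex in [x] because
    [0 <= t]; the identity in the proof is its interpolation between [y1] and [y2]. *)
Lemma bvp0_sol_superlevel (t y1 y2 : R) : 0 <= t -> t <= W0 y1 -> t <= W0 y2 ->
  {in `[y1, y2], forall x, t <= W0 x}.
Proof.
move=> t0; rewrite !bvp0_sol_ge => ty1 ty2 x; rewrite in_itv/= => /andP[y1x xy2].
rewrite bvp0_sol_ge; move: y1x; rewrite le_eqVlt => /predU1P[<-//|y1x].
have y12 : 0 < y2 - y1 by lra.
rewrite -subr_ge0 -(pmulr_rge0 _ y12).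
rewrite [leRHS](_ : _ = (y2 - x) * ((a + b) * y1 - t * (y1 ^+ 2 + a * b)) +
  (x - y1) * ((a + b) * y2 - t * (y2 ^+ 2 + a * b)) +
  t * (x - y1) * (y2 - x) * (y2 - y1)); last by ring.
by rewrite !addr_ge0// !mulr_ge0//; lra.
Qed.

(* The superlevel interval of [bvp0_sol a b] with end points in the ratio
   [be / al] is obtained by scaling [al, be] to geometric mean [sqrt (a b)]. *)
Lemma bvp0_sol_scale (t al be : R) : 1 < t -> 0 < al -> al < be ->
  t ^+ 2 * ratio_sq al be <= ratio_sq a b ->
  exists2 g, 0 < g & [/\ t <= W0 (g * al), t <= W0 (g * be) &
    t ^+ 2 * ratio_sq al be < ratio_sq a b ->
    exists2 y, g * be < y & t <= W0 y].
Proof.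
have a0 := a_gt0; have ab := a_lt_b; move=> t1 al0 albe.
have be0 : 0 < be by lra.
have b0 : 0 < b by lra.
pose g := Num.sqrt (a * b / (al * be)).
have g0 : 0 < g by rewrite sqrtr_gt0 divr_gt0// mulr_gt0.
have g2 : g ^+ 2 * (al * be) = a * b.
  by rewrite sqr_sqrtr ?divfK ?mulf_neq0 ?gt_eqF// divr_ge0 ?mulr_ge0// ltW.
have sqE : t ^+ 2 * ratio_sq al be * (a * b) = (t * (g * (al + be))) ^+ 2.
  by rewrite -g2 /ratio_sq; field; rewrite !gt_eqF.
have abE : ratio_sq a b * (a * b) = (a + b) ^+ 2.
  by rewrite /ratio_sq divfK// mulf_neq0 ?gt_eqF.
have ab2 : 0 < a * b by rewrite mulr_gt0.
have pos1 : 0 <= t * (g * (al + be)) by rewrite !mulr_ge0//; lra.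
have pos2 : 0 <= a + b by lra.
rewrite -(ler_pM2r ab2) -(ltr_pM2r ab2) sqE abE.
rewrite ler_pXn2r ?nnegrE// ltr_pXn2r ?nnegrE// => tle.
exists g => //; rewrite !bvp0_sol_ge -g2.
(* When [g^2 * (x * y) = a * b], the condition [t <= W0 (g * x)] reduces to
   [t * (g * (x + y)) <= a + b]. This is symmetric in [x] and [y], so [tle] serves both ends. *)
have E (x y : R) : t * ((g * x) ^+ 2 + g ^+ 2 * (x * y)) = g * x * (t * (g * (x + y))).
  by ring.
split.
- by rewrite E mulrC ler_wpM2r// mulr_ge0// ltW.
- rewrite (mulrC al) E (addrC be) mulrC ler_wpM2r// mulr_ge0//; lra.
move=> tlt; set y := g * be.
have y0 : 0 < y by rewrite mulr_gt0.
(* [q] is the slack of the quadratic inequality at [y]; a shift to the right by [d <= 1] uses up at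
   most [d * K] of it. *)
pose q := y * (a + b - t * (g * (al + be))).
have q0 : 0 < q by rewrite mulr_gt0// subr_gt0.
have qE : q = (a + b) * y - t * (y ^+ 2 + a * b) by rewrite /q -g2 /y; ring.
pose K := t * (2 * y + 1).
have K0 : 0 < K by rewrite mulr_gt0//; lra.
pose d := Num.min 1 (q / K).
have d0 : 0 < d by rewrite lt_min ltr01 divr_gt0.
have d1 : d <= 1 by rewrite ge_min lexx.
have dK : d * K <= q by rewrite -ler_pdivlMr// ge_min lexx orbT.
exists (y + d); first by rewrite ltrDl.
rewrite bvp0_sol_ge -subr_ge0.
rewrite (_ : _ - _ = (q - d * K) + d * (a + b) + t * (d * (1 - d))); last first.
  by rewrite qE /K; ring.
have : 0 <= d * (a + b) by rewrite mulr_ge0// ltW.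
have : 0 <= t * (d * (1 - d)) by rewrite !mulr_ge0//; lra.
lra.
Qed.

End bvp0_sol_theory.

Lemma lt_integral_neq d (T : measurableType d) (R : realType)
    (mu : {measure set T -> \bar R}) (D I : set T) (f g : T -> \bar R) :
  measurable D -> measurable I -> I `<=` D -> (0 < mu I)%E ->
  measurable_fun D f -> measurable_fun D g ->
  (forall x, D x -> 0 <= f x)%E -> (forall x, D x -> f x \is a fin_num) ->
  (forall x, D x -> f x <= g x)%E -> (forall x, I x -> f x < g x)%E ->
  (\int[mu]_(x in D) f x < +oo)%E ->
  (\int[mu]_(x in D) f x <> \int[mu]_(x in D) g x)%E.
Proof.
move=> mD mI ID muI mf mg f0 ffin fg Ifg foo fgE.
have g0 x : D x -> (0 <= g x)%E by move=> Dx; exact: le_trans (f0 _ Dx) (fg _ Dx).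
have intf : mu.-integrable D f.
  apply/integrableP; split => //.
  by under eq_integral => x /set_mem Dx do rewrite gee0_abs ?f0//.
have intg : mu.-integrable D g.
  apply/integrableP; split => //.
  by under eq_integral => x /set_mem Dx do rewrite gee0_abs ?g0//; rewrite -fgE.
have : (\int[mu]_(x in D) `|(g \- f) x| = 0)%E.
  under eq_integral => x /set_mem Dx do rewrite gee0_abs ?sube_ge0 ?ffin ?fg//.
  rewrite integralB// -fgE subee// ge0_fin_numE//; exact: integral_ge0.
have mgf : measurable_fun D (g \- f)%E by apply: emeasurable_funB.
move=> /(ae_eq_integral_abs mu mD mgf)[N [mN N0 subN]].
have IN : I `<=` N.
  move=> x Ix; apply: subN => /= /(_ (ID _ Ix)) gf0.
  by have := Ifg _ Ix; rewrite -sube_gt0 gf0 ltxx.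
have : (mu I <= mu N)%E by apply: le_measure; rewrite ?inE.
by rewrite N0 leNgt muI.
Qed.

Section distribution.
Context {R : realType}.
Variables (a b : R) (rho w : R -> R) (lambda : R).
Hypotheses (a_gt0 : 0 < a) (a_lt_b : a < b)
  (rho_ge0 : {in `[a, b], forall x, 0 <= rho x})
  (rho_nd : {in `[a, b] &, {homo rho : x y / x <= y}})
  (w_sol : solves_bvp a b rho w lambda)
  (w_gt1 : {in `]a, b[, forall x, 1 < w x}).
Local Notation W0 := (bvp0_sol a b).
Local Notation M := (invx_measure R).
Let D := `]a, b[%classic : set R.
Let E (u : R -> R) t := D `&` [set x | t <= u x].

Let D_pos : D `<=` `]0%R, +oo[%classic.
Proof.
by move=> x; rewrite /D /= !in_itv/= andbT => /andP[ax _]; exact: lt_trans ax.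
Qed.

Let mD : measurable (D : set (lebesgueTypeR R)).
Proof. by apply: measurable_lebesgueTypeR; exact: measurable_itv. Qed.

Let cw : {in `]a, b[, continuous w}.
Proof.
move=> x; rewrite in_itv/= => /andP[ax xb].
exact: (lip_on_continuous ax xb (solves_bvp_lip w_sol)).
Qed.

Let measurable_D (u : R -> R) : {in `]a, b[, continuous u} ->
  measurable_fun (D : set (measurableTypeR R)) u.
Proof.
move=> cu; apply: open_continuous_measurable_fun; first exact: interval_open.
by move=> x /set_mem; exact: cu.
Qed.

Let measurable_E (u : R -> R) t : {in `]a, b[, continuous u} ->
  measurable (E u t : set (lebesgueTypeR R)).
Proof.
move=> cu; apply: measurable_lebesgueTypeR.
have := measurable_D cu (measurable_itv `]a, b[) (measurable_itv `[t, +oo[).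
congr measurable; apply/seteqP.
by split => x [Dx]; rewrite /= in_itv/= andbT.
Qed.

Let cW0 : {in `]a, b[, continuous W0}.
Proof. by move=> x _; exact: continuous_bvp0_sol. Qed.

Let w_ge1 : {in `[a, b], forall x, 1 <= w x}.
Proof.
have [_ _ wa wb] := w_sol.
move=> x; rewrite in_itv/= => /andP[]; rewrite le_eqVlt => /predU1P[<-|ax].
  by rewrite wa.
rewrite le_eqVlt => /predU1P[->|xb]; first by rewrite wb.
by apply/ltW/w_gt1; rewrite in_itv/= ax.
Qed.

Let M_itv_E (t c d : R) : 1 < t -> 0 < c -> c <= d -> t <= W0 c -> t <= W0 d ->
  ((ln d - ln c)%:E <= M (E W0 t))%E.
Proof.
move=> t1 c0 cd tc td; rewrite -invx_measure_itv//.
have t0 : 0 <= t by lra.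
have sup := bvp0_sol_superlevel a_gt0 a_lt_b t0 tc td.
apply: le_measure; rewrite ?inE.
- exact: measurable_lebesgueTypeR.
- exact: measurable_E.
move=> x /sup tx; split => //=.
suff : x \in `]a, b[ by []; rewrite -bvp0_sol_gt1//; exact: lt_le_trans tx.
Qed.

(** [dx / x] is invariant under scaling, so the factor from [bvp0_sol_scale] moves the hull of
    [{w >= t}] into [{W0 >= t}] without changing its measure. In the strict case the target contains
    a further interval beyond the right end. *)
Lemma superlevel_measure_pair (t x1 x2 : R) : 1 < t ->
  a <= x1 -> x1 < x2 -> x2 <= b -> t <= w x1 -> t <= w x2 ->
  (M (E w t) <= M (E W0 t))%E /\ (0 < rho x2 -> (M (E w t) < M (E W0 t))%E).
Proof.
have a0 := a_gt0; move=> t1 ax1 x12 x2b tx1 tx2.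
have [_ _ wa wb] := w_sol.
have [al [be [aal albe beb [supw tQ tQs]]]] :=
  @superlevel_ratio_lt _ a b rho w lambda a_gt0 rho_ge0 rho_nd
    (solves_bvp_lip w_sol) (solves_bvp_ae_ode w_sol) wa wb w_ge1 t x1 x2
    ax1 x12 x2b t1 tx1 tx2.
have al0 : 0 < al by lra.
have be0 : 0 < be by lra.
have Mw : (M (E w t) <= (ln be - ln al)%:E)%E.
  rewrite -(invx_measure_itv al0 (ltW albe)); apply: le_measure; rewrite ?inE.
  - exact: measurable_E.
  - exact: measurable_lebesgueTypeR.
  move=> x [Dx tx] /=; rewrite in_itv/=; apply: supw => //.
  exact: subset_itv_oo_cc Dx.
have [g g0 [tg1 tg2 tg3]] := bvp0_sol_scale a_gt0 a_lt_b t1 al0 albe tQ.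
have gal : 0 < g * al by rewrite mulr_gt0.
have galbe : g * al < g * be by rewrite ltr_pM2l.
have lnE : ln be - ln al = ln (g * be) - ln (g * al).
  by rewrite !lnM ?posrE//; ring.
split.
  by apply: (le_trans Mw); rewrite lnE; apply: M_itv_E => //; exact: ltW.
move=> /tQs /tg3[y gy ty].
apply: (le_lt_trans Mw); apply: lt_le_trans (M_itv_E t1 gal _ tg1 ty); last first.
  by apply/ltW; exact: lt_trans gy.
rewrite lnE lte_fin ltrD2r ltr_ln// posrE; first exact: lt_trans galbe.
by apply: lt_trans gy; exact: lt_trans galbe.
Qed.

(** The bound on hulls needs two points; a superlevel set with at most one is null. *)
Lemma superlevel_measure_le (t : R) : 1 < t -> (M (E w t) <= M (E W0 t))%E.
Proof.
move=> t1.
have [[x1 [x2 [x1D x12 x2D tx1 tx2]]]|no_pair] := pselect (exists x1 x2,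
    [/\ D x1, x1 < x2, D x2, t <= w x1 & t <= w x2]).
  move: x1D x2D; rewrite /D /= !in_itv/= => /andP[ax1 _] /andP[_ x2b].
  by have [] := superlevel_measure_pair t1 (ltW ax1) x12 (ltW x2b) tx1 tx2.
have [[x Ex]|noE] := pselect (exists x, E w t x); last first.
  rewrite (_ : E w t = set0) ?measure0//.
  by apply/seteqP; split => // x Ex; apply: noE; exists x.
rewrite (_ : E w t = [set x]).
  have x0 : 0 < x by case: Ex => /D_pos; rewrite /= in_itv/= andbT.
  by rewrite invx_measure1.
apply/seteqP; split => [y Ey|y ->//]; apply: contrapT => /eqP yx.
apply: no_pair; case: Ex => Dx tx; case: Ey => Dy ty.
by move: yx; rewrite /= neq_lt => /orP[yx|xy]; [exists y, x | exists x, y].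
Qed.

Variable phi : R -> R.
Hypotheses (phi_ge0 : {in `]1, +oo[, forall t, 0 <= phi t})
  (phi_cont : {in `]1, +oo[, continuous phi})
  (phi_decr : {in `]1, +oo[ &, {homo phi : s t /~ s < t}}).

Let L (u : R -> R) s := D `&` [set x | s < phi (u x)].

Let gt1E (t : R) : (t \in `]1, +oo[) = (1 < t).
Proof. by rewrite in_itv/= andbT. Qed.

Let phi_lt (t x : R) : 1 < t -> 1 < x -> (phi t < phi x) = (x < t).
Proof.
move=> t1 x1; apply/idP/idP => [h|]; last by apply: phi_decr; rewrite gt1E.
rewrite ltNge; apply/negP; rewrite le_eqVlt => /predU1P[tx|tx].
  by move: h; rewrite tx ltxx.
have : phi x < phi t by apply: phi_decr; rewrite ?gt1E.
by move=> /(lt_trans h); rewrite ltxx.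
Qed.

Let MD_lty : (M D < +oo)%E.
Proof. exact: invx_measure_itvoo_lty. Qed.

Let cphi (u : R -> R) : {in `]a, b[, continuous u} ->
  {in `]a, b[, forall x, 1 < u x} -> {in `]a, b[, continuous (phi \o u)}.
Proof.
move=> cu u1 x xD; apply: continuous_comp; first exact: cu.
by apply: phi_cont; rewrite gt1E u1.
Qed.

Let measurable_L (u : R -> R) s : {in `]a, b[, continuous u} ->
  {in `]a, b[, forall x, 1 < u x} -> measurable (L u s : set (lebesgueTypeR R)).
Proof.
move=> cu u1; apply: measurable_lebesgueTypeR.
have := measurable_D (cphi cu u1) (measurable_itv `]a, b[) (measurable_itv `]s, +oo[).
congr measurable; apply/seteqP.
by split => x [Dx]; rewrite /= in_itv/= andbT.
Qed.

(** As [phi] reverses the order, its layers are complements of superlevel sets in [D]. Subtraction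
    from the finite [M D] turns the upper bound for [w] into a lower bound on layers. *)
Let layerE (u : R -> R) t : {in `]a, b[, continuous u} ->
  {in `]a, b[, forall x, 1 < u x} ->
  1 < t -> M (L u (phi t)) = (M D - M (E u t))%E.
Proof.
move=> cu u1 t1; rewrite (_ : L u (phi t) = D `\` E u t).
  rewrite measureD//; last exact: measurable_E.
  by rewrite (_ : D `&` E u t = E u t)// /E setIA setIid.
apply/seteqP; split => x /=.
  by move=> [Dx]; rewrite /= phi_lt ?u1// => ut; split => // -[_] /=; rewrite leNgt ut.
move=> [Dx nE]; split => //=; rewrite phi_lt ?u1// ltNge; apply/negP => tu.
by apply: nE.
Qed.

Let gt1_W0 : {in `]a, b[, forall x, 1 < W0 x}.
Proof. by move=> x xD; rewrite bvp0_sol_gt1. Qed.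

Let MD_fin : M D \is a fin_num. Proof. by rewrite ge0_fin_numE. Qed.

(** If no value of [phi] exceeds [s], the layer of [W0] is empty; if all do, the layer of [w] is
    [D]. Otherwise [s = phi t] by the intermediate value theorem. *)
Let layer_le s : (M (L W0 s) <= M (L w s))%E.
Proof.
have [[t1 [t1_gt1 st1]]|low] := pselect (exists t, 1 < t /\ s < phi t); last first.
  rewrite (_ : L W0 s = set0) ?measure0//.
  apply/seteqP; split => // x [Dx sx]; apply: low; exists (W0 x).
  by split => //; exact: gt1_W0.
have [[t2 [t2_gt1 st2]]|high] := pselect (exists t, 1 < t /\ phi t <= s); last first.
  rewrite (_ : L w s = D).
    apply: le_measure; rewrite ?inE; last exact: subIsetl.
      exact: measurable_L.
    exact: mD.
  apply/seteqP; split => [x []//|x Dx]; split => //=; rewrite ltNge.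
  by apply/negP => ws; apply: high; exists (w x); split => //; exact: w_gt1.
have t12 : t1 < t2.
  by rewrite -phi_lt//; exact: le_lt_trans st1.
have [||t t12' <-] := @IVT _ phi t1 t2 s (ltW t12).
- apply: continuous_in_subspaceT => x /set_mem /=; rewrite in_itv/= => /andP[t1x _].
  by apply: phi_cont; rewrite gt1E; exact: lt_le_trans t1x.
- by rewrite ge_min st2 orbT le_max (ltW st1).
have t_gt1 : 1 < t.
  by move: t12'; rewrite in_itv/= => /andP[+ _]; exact: lt_le_trans.
rewrite !layerE//; apply: leeB => //; exact: superlevel_measure_le.
Qed.

Let measurable_phi (u : R -> R) : {in `]a, b[, continuous u} ->
  {in `]a, b[, forall x, 1 < u x} ->
  measurable_fun (D : set (lebesgueTypeR R)) (phi \o u).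
Proof.
move=> cu u1; apply: measurable_fun_lebesgueTypeR; first exact: measurable_itv.
exact: measurable_D (cphi cu u1).
Qed.

Let integral_phiE (u : R -> R) : {in `]a, b[, continuous u} ->
  {in `]a, b[, forall x, 1 < u x} ->
  (\int[M]_(x in D) (phi (u x))%:E =
   \int[lebesgue_measure]_(s in `[0%R, +oo[) M (L u s))%E.
Proof.
move=> cu u1; rewrite (integral_layer_cake mD MD_lty (measurable_phi cu u1))//.
by move=> x Dx; rewrite phi_ge0// gt1E u1.
Qed.

Let measurable_layer_phi (u : R -> R) : {in `]a, b[, continuous u} ->
  {in `]a, b[, forall x, 1 < u x} ->
  measurable_fun (`[0%R, +oo[%classic : set (measurableTypeR R)) (fun s => M (L u s)).
Proof.
by move=> cu u1; exact: measurable_layer mD MD_lty _ (measurable_phi cu u1).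
Qed.

Lemma integral_phi_ge :
  (\int[M]_(x in `]a, b[) (phi (W0 x))%:E <= \int[M]_(x in `]a, b[) (phi (w x))%:E)%E.
Proof.
rewrite (integral_phiE cW0 gt1_W0) (integral_phiE cw w_gt1).
apply: ge0_le_integral.
- exact: measurable_itv.
- by move=> s _; exact: measure_ge0.
- exact: measurable_layer_phi cW0 gt1_W0.
- exact: measurable_layer_phi cw w_gt1.
- by move=> s _; exact: layer_le.
Qed.

(** A strict gain is needed on levels filling an interval. Two points [x1 < x2] to the right of [c],
    so that [0 < rho x2], belong to the superlevel sets of [w] at all levels between [T0] and [T],
    and [phi] maps these levels onto an interval of positive length. *)
Lemma integral_phi_neq (c : R) : c \in `[a, b[ -> 0 < rho c ->
  (\int[M]_(x in `]a, b[) (phi (W0 x))%:E < +oo)%E ->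
  (\int[M]_(x in `]a, b[) (phi (W0 x))%:E <>
   \int[M]_(x in `]a, b[) (phi (w x))%:E)%E.
Proof.
rewrite in_itv/= => /andP[ac cb] rc.
rewrite (integral_phiE cW0 gt1_W0) (integral_phiE cw w_gt1).
pose x1 := (c + b) / 2; pose x2 := (x1 + b) / 2.
have cx1 : c < x1 by rewrite /x1; lra.
have x12 : x1 < x2 by rewrite /x2 /x1; lra.
have x2b : x2 < b by rewrite /x2 /x1; lra.
have x1D : x1 \in `]a, b[ by rewrite in_itv/=; apply/andP; split; lra.
have x2D : x2 \in `]a, b[ by rewrite in_itv/=; apply/andP; split; lra.
have rx2 : 0 < rho x2.
  by apply: lt_le_trans rc _; apply: rho_nd; rewrite ?in_itv/=; lra.
pose T := Num.min (w x1) (w x2).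
have T1 : 1 < T by rewrite lt_min !w_gt1.
pose T0 := (1 + T) / 2.
have T01 : 1 < T0 by rewrite /T0; lra.
have T0T : T0 < T by rewrite /T0; lra.
have phiT : phi T < phi T0 by rewrite phi_lt.
have phiT_ge0 : 0 <= phi T by rewrite phi_ge0// gt1E.
move=> fin; apply: (@lt_integral_neq _ (measurableTypeR R) R lebesgue_measure
  `[0%R, +oo[%classic `]phi T, phi T0[%classic).
- exact: measurable_itv.
- exact: measurable_itv.
- move=> s /=; rewrite !in_itv/= andbT => /andP[Ts _].
  by apply/ltW; exact: le_lt_trans Ts.
- rewrite [ltRHS](lebesgue_measure_itv `]phi T, phi T0[)/= lte_fin phiT.
  by rewrite lte_fin subr_gt0.
- exact: measurable_layer_phi.
- exact: measurable_layer_phi.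
- by [].
- move=> s _; rewrite ge0_fin_numE//; apply: le_lt_trans MD_lty.
  by apply: le_measure; rewrite ?inE; [exact: measurable_L | exact: mD | exact: subIsetl].
- by move=> s _; exact: layer_le.
- move=> s /=; rewrite in_itv/= => /andP[Ts sT0].
  have [||t] := @IVT _ phi T0 T s (ltW T0T).
  - apply: continuous_in_subspaceT => x /set_mem /=; rewrite in_itv/= => /andP[T0x _].
    by apply: phi_cont; rewrite gt1E; exact: lt_le_trans T0x.
  - by rewrite ge_min (ltW Ts) orbT le_max (ltW sT0).
  rewrite in_itv/= => /andP[T0t tT] <-.
  have t_gt1 : 1 < t by exact: lt_le_trans T0t.
  have tw1 : t <= w x1 by apply: le_trans tT _; rewrite ge_min lexx.
  have tw2 : t <= w x2 by apply: le_trans tT _; rewrite ge_min lexx orbT.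
  rewrite !layerE// lteD2lE// lteN2.
  have ax1 : a <= x1 by lra.
  by have [_] := superlevel_measure_pair t_gt1 ax1 x12 (ltW x2b) tw1 tw2; apply.
- exact: fin.
Qed.

End distribution.

(** * The constant [pi] *)

(** At 1 the graph of [asin] has a vertical tangent; the limit is obtained from strict monotonicity
    of [sin] on [[- pi / 2, pi / 2]]. *)
Lemma cvg_asin1 (R : realType) (u : R^nat) : (forall n, -1 <= u n <= 1) ->
  u @ \oo --> (1 : R) -> asin (u n) @[n --> \oo] --> (pi / 2 : R).
Proof.
move=> u1 uc; apply/cvgrPdist_lt => e e0.
have p0 := pi_gt0 R.
(* Capping at [pi] keeps [pi / 2 - e'] where [sin] is monotone. *)
pose e' := Num.min e pi.
have e'0 : 0 < e' by rewrite lt_min e0.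
have e'p : e' <= pi by rewrite ge_min lexx orbT.
have e'e : e' <= e by rewrite ge_min lexx.
have i1 : pi / 2 - e' \in `[- (pi / 2), pi / 2 : R].
  by rewrite in_itv/=; apply/andP; split; lra.
have s1 : sin (pi / 2 - e') < 1.
  have i2 : pi / 2 \in `[- (pi / 2), pi / 2 : R].
    by rewrite in_itv/=; apply/andP; split; lra.
  by rewrite -[ltRHS]sin_pihalf ltr_sin//; lra.
near=> n.
have un : sin (pi / 2 - e') < u n by near: n; exact: cvgr_gt uc _ s1.
have [/andP[as1 as2] sasin] := asin_def (u1 n).
have : pi / 2 - e' < asin (u n).
  by rewrite -ltr_sin// ?sasin// in_itv/= as1.
by rewrite ger0_norm; lra.
Unshelve. all: by end_near. Qed.

Lemma asinN (R : realType) (x : R) : -1 <= x <= 1 -> asin (- x) = - asin x.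
Proof.
move=> x1; have x1N : -1 <= - x <= 1 by move: x1 => /andP[? ?]; apply/andP; split; lra.
have [/andP[? ?] sx] := asin_def x1; have [/andP[? ?] sNx] := asin_def x1N.
apply: sin_inj; rewrite ?in_itv/=; first by apply/andP.
  by apply/andP; split; lra.
by rewrite sinN sx sNx.
Qed.

Section bvp0_sol_pi.
Context {R : realType}.
Variables (a b : R).
Hypotheses (a_gt0 : 0 < a) (a_lt_b : a < b).
Local Notation W0 := (bvp0_sol a b).
(** With [x = sqrt (a b) exp s] and [C = (a + b) / (2 sqrt (a b))] one has [W0 x = C / cosh s] and
    [dx / x = ds]. The integrand becomes [cosh s / sqrt (C^2 - 1 - sinh^2 s)], with primitive the
    arcsine of [sinh s / sqrt (C^2 - 1)], which is [h x]. It runs from -1 at [a] to 1 at [b]; [k] is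
    [x] times the derivative of [h]. *)
Let h (x : R) := (x - a * b * x^-1) / (b - a).
Let k (x : R) := (x ^+ 2 + a * b) / ((b - a) * x).
Let S (x : R) := Num.sqrt (W0 x ^+ 2 - 1).

Let pos x : x \in `]a, b[ -> 0 < x.
Proof. by rewrite in_itv/= => /andP[ax _]; exact: lt_trans ax. Qed.

Let W0_sqr_gt1 x : x \in `]a, b[ -> 0 < W0 x ^+ 2 - 1.
Proof.
move=> xD; rewrite subr_gt0 -[ltLHS](expr1n _ 2).
rewrite ltr_pXn2r ?nnegrE ?bvp0_sol_gt1//.
by apply/ltW/(lt_trans ltr01); rewrite bvp0_sol_gt1.
Qed.

Let S_gt0 x : x \in `]a, b[ -> 0 < S x.
Proof. by move=> xD; rewrite sqrtr_gt0 W0_sqr_gt1. Qed.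

Let k_gt0 x : x \in `]a, b[ -> 0 < k x.
Proof.
have ab := a_lt_b; have a0 := a_gt0; move=> xD; have x0 := pos xD.
have b0 : 0 < b by lra.
apply: divr_gt0; last by apply: mulr_gt0 => //; lra.
by apply: addr_gt0; [exact: exprn_gt0 | exact: mulr_gt0].
Qed.

Let hk x : x \in `]a, b[ -> 1 - h x ^+ 2 = (W0 x ^+ 2 - 1) * k x ^+ 2.
Proof.
have ab := a_lt_b; have a0 := a_gt0; move=> xD; have x0 := pos xD.
have b0 : 0 < b by lra.
have x2 : 0 < x ^+ 2 + a * b.
  by apply: addr_gt0; [exact: exprn_gt0 | exact: mulr_gt0].
rewrite /h /k /bvp0_sol; field.
by rewrite (gt_eqF x0) (gt_eqF x2) gt_eqF ?subr_gt0.
Qed.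

Let h_itv x : x \in `]a, b[ -> -1 < h x < 1.
Proof.
move=> xD; have : 0 < 1 - h x ^+ 2.
  by rewrite hk// mulr_gt0 ?W0_sqr_gt1// exprn_gt0 ?k_gt0.
by rewrite subr_gt0 -real_normK ?num_real// expr_lt1// ltr_norml.
Qed.

Let sqrt_h x : x \in `]a, b[ -> Num.sqrt (1 - h x ^+ 2) = S x * k x.
Proof.
move=> xD; rewrite hk// sqrtrM ?sqrtr_sqr ?gtr0_norm ?k_gt0//.
exact/ltW/W0_sqr_gt1.
Qed.

Let dF x : x \in `]a, b[ -> is_derive x 1 (asin \o h) ((S x)^-1 * x^-1).
Proof.
have ab := a_lt_b; move=> xD; have x0 := pos xD; have xn0 : x != 0 by rewrite gt_eqF.
have di := is_derive_id x (1 : R); have dc (r : R) := is_derive_cst r x (1 : R).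
have dh : is_derive x 1 h (k x * x^-1).
  have d := is_derive1M (is_derive1D di (is_derive1N (is_derive1M (dc (a * b))
    (is_derive1_inv xn0 di)))) (dc (b - a)^-1).
  apply: (is_derive_eq d) => /=; rewrite /k; field.
  by rewrite xn0 gt_eqF ?subr_gt0.
have das := is_derive1_asin (h_itv xD).
apply: is_derive_eq.
have kn0 : k x != 0 by rewrite gt_eqF ?k_gt0.
have Sn0 : S x != 0 by rewrite gt_eqF ?S_gt0.
by rewrite sqrt_h//; field; rewrite kn0 Sn0 xn0.
Qed.

Let cS : continuous S.
Proof.
move=> x; apply: (@cvg_comp _ _ _ (fun x => W0 x ^+ 2 - 1) Num.sqrt);
  last exact: sqrt_continuous.
apply: cvgB; last exact: cvg_cst.
apply: (@cvg_comp _ _ _ W0 (fun y => y ^+ 2)); last exact: exprn_continuous.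
exact: continuous_bvp0_sol.
Qed.

Let cg x : x \in `]a, b[ -> {for x, continuous (fun x => (S x)^-1 * x^-1)}.
Proof.
move=> xD; apply: cvgM; last by apply: inv_continuous; rewrite gt_eqF// pos.
apply: cvgV; first by rewrite gt_eqF// S_gt0.
exact: cS.
Qed.

Lemma integral_bvp0_sol_pi :
  (\int[invx_measure R]_(x in `]a, b[) ((Num.sqrt (W0 x ^+ 2 - 1))^-1)%:E = pi%:E)%E.
Proof.
have ab := a_lt_b; have a0 := a_gt0.
rewrite (@integral_invx _ `]a, b[%classic (fun x => (S x)^-1)); last 4 first.
- exact: measurable_itv.
- by move=> x /= /pos; rewrite in_itv/= andbT.
- apply: open_continuous_measurable_fun; first exact: interval_open.
  move=> x /set_mem xD; apply: cvgV; first by rewrite gt_eqF// S_gt0.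
  exact: cS.
- by move=> x /set_mem xD; rewrite invr_ge0 ltW// S_gt0.
(* The integrand is unbounded at both ends, so []a, b[] is exhausted from inside. At [n = 0] the
   interval is the midpoint alone. *)
pose m := (b - a) / 2; have m0 : 0 < m by rewrite /m; lra.
pose e (n : nat) := m / n.+1%:R.
have e0 n : 0 < e n by rewrite divr_gt0.
have em n : e n <= m by rewrite ler_pdivrMr// ler_pMr// ler1n.
have mE : m = (b - a) / 2 by [].
have e_cvg : e @ \oo --> 0.
  rewrite -[X in _ --> X](mulr0 m); apply: cvgM; first exact: cvg_cst.
  exact: cvg_harmonic.
pose F n := `[a + e n, b - e n]%classic : set (measurableTypeR R).
have FD n x : F n x -> x \in `]a, b[.
  rewrite /F /= !in_itv/= => /andP[? ?]; have := e0 n => ?.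
  by apply/andP; split; lra.
have UF : \bigcup_n F n = `]a, b[%classic.
  apply/seteqP; split => [x [n _] /FD//|x xD].
  have d0 : 0 < Num.min (x - a) (b - x).
    by move: xD; rewrite /= in_itv/= => /andP[? ?]; rewrite lt_min !subr_gt0; apply/andP.
  have : \forall n \near \oo, e n < Num.min (x - a) (b - x).
    exact: cvgr_lt e_cvg _ d0.
  move=> [N _ /(_ N (leqnn N))] /=; rewrite lt_min => /andP[? ?].
  by exists N => //; rewrite /F /= in_itv/=; apply/andP; split; lra.
have IF n : (\int[lebesgue_measure]_(x in F n) ((S x)^-1 * x^-1)%:E =
    (asin (h (b - e n)) - asin (h (a + e n)))%:E)%E.
  have := em n => ?; apply: (@FTC2_is_derive _ (asin \o h)).
  - by lra.
  - by move=> x /FD xD; exact: dF.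
  - by move=> x /FD xD; exact: cg.
have mg n : measurable_fun (F n) (fun x => ((S x)^-1 * x^-1)%:E).
  apply/measurable_EFinP.
  apply: (@measurable_funS _ _ (measurableTypeR R) _ `]a, b[%classic) => //.
    by move=> x /FD.
  apply: open_continuous_measurable_fun; first exact: interval_open.
  by move=> x /set_mem xD; exact: cg.
have := @ge0_nondecreasing_set_cvg_integral _ (measurableTypeR R) R F
  (fun x => ((S x)^-1 * x^-1)%:E) lebesgue_measure.
rewrite UF => /(_ _ _ mg _) cvgF.
have {}cvgF : (\int[lebesgue_measure]_(x in F n) ((S x)^-1 * x^-1)%:E)%E @[n --> \oo]
    --> (\int[lebesgue_measure]_(x in `]a, b[) ((S x)^-1 * x^-1)%:E)%E.
  apply: cvgF.
  - move=> n n' nn'; apply/subsetPset => x; rewrite /F /= !in_itv/= => /andP[? ?].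
    have : e n' <= e n by rewrite ler_pM2l// lef_pV2 ?posrE// ler_nat.
    by move=> ?; apply/andP; split; lra.
  - by move=> n; exact: measurable_itv.
  - by move=> n x /FD xD; rewrite lee_fin mulr_ge0// invr_ge0 ltW// ?S_gt0// pos.
rewrite (_ : (fun n => _) =
    (fun n => (asin (h (b - e n)) - asin (h (a + e n)))%:E)) in cvgF;
  last by apply/funext => n; rewrite IF.
apply: (cvg_unique _ cvgF) => //.
have itv1 x : x \in `]a, b[ -> -1 <= h x <= 1.
  by move=> /h_itv /andP[? ?]; apply/andP; split; exact: ltW.
have ch x : 0 < x -> {for x, continuous h}.
  move=> x0; apply: cvgM; last exact: cvg_cst.
  apply: cvgB; first exact: cvg_id.
  by apply: cvgM; [exact: cvg_cst | apply: inv_continuous; rewrite gt_eqF].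
have hb : h b = 1 by rewrite /h; field; rewrite !gt_eqF ?subr_gt0//; lra.
have ha : h a = -1 by rewrite /h; field; rewrite !gt_eqF ?subr_gt0//; lra.
have inD1 n : b - e n \in `]a, b[.
  by rewrite in_itv/=; have := em n; have := e0 n => ? ?; apply/andP; split; lra.
have inD2 n : a + e n \in `]a, b[.
  by rewrite in_itv/=; have := em n; have := e0 n => ? ?; apply/andP; split; lra.
have c1 : b - e n @[n --> \oo] --> b.
  by rewrite -[X in _ --> X]subr0; apply: cvgB => //; exact: cvg_cst.
have c2 : a + e n @[n --> \oo] --> a.
  by rewrite -[X in _ --> X]addr0; apply: cvgD => //; exact: cvg_cst.
have l1 : asin (h (b - e n)) @[n --> \oo] --> (pi / 2 : R).
  apply: cvg_asin1; first by move=> n; exact: itv1.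
  rewrite -[X in _ --> X]hb; apply: (@cvg_comp _ _ _ (fun n => b - e n) h).
    exact: c1.
  by apply: ch; lra.
(* Oddness of [asin] reduces the limit at -1 to the one at 1. *)
have l2 : asin (- h (a + e n)) @[n --> \oo] --> (pi / 2 : R).
  apply: cvg_asin1.
    by move=> n; have /andP[? ?] := itv1 _ (inD2 n); apply/andP; split; lra.
  rewrite -[X in _ --> X]opprK -ha; apply: cvgN.
  apply: (@cvg_comp _ _ _ (fun n => a + e n) h); last exact: ch.
  exact: c2.
apply: cvg_EFin; first by near=> n.
rewrite (_ : pi = pi / 2 + pi / 2); last by rewrite -splitr.
apply: cvg_trans (cvgD l1 l2); apply: near_eq_cvg; near=> n.
by rewrite fctE /= asinN ?itv1.
Unshelve. all: by end_near. Qed.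

End bvp0_sol_pi.

(** * The function [1 / sqrt (t^2 - 1)] and the theorem *)

Lemma continuous_inv_sqrt (R : realType) :
  {in `]1, +oo[, continuous (fun t : R => (Num.sqrt (t ^+ 2 - 1))^-1)}.
Proof.
move=> t; rewrite in_itv/= andbT => t1.
apply: cvgV.
  by rewrite gt_eqF// sqrtr_gt0 subr_gt0 expr_gt1// ltW// (lt_trans ltr01).
apply: (@cvg_comp _ _ _ (fun t : R => t ^+ 2 - 1) Num.sqrt);
  last exact: sqrt_continuous.
by apply: cvgB; [exact: exprn_continuous | exact: cvg_cst].
Qed.

Lemma inv_sqrt_decr (R : realType) :
  {in `]1, +oo[ &, {homo (fun t : R => (Num.sqrt (t ^+ 2 - 1))^-1) : s t /~ s < t}}.
Proof.
move=> s t; rewrite !in_itv/= !andbT => s1 t1 ts.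
have pos (x : R) : 1 < x -> 0 < x ^+ 2 - 1.
  by move=> x1; rewrite subr_gt0 expr_gt1// ltW// (lt_trans ltr01).
rewrite ltf_pV2 ?posrE ?sqrtr_gt0 ?pos// ltr_sqrt ?pos// ltrD2r.
by rewrite ltr_pXn2r ?nnegrE ?(le_trans ler01) ?ltW.
Qed.

Unset Implicit Arguments.

Theorem corollary9p16 (R : realType) (a b : R) (rho w : R -> R) (lambda : R)
    (a_gt0 : 0 < a) (a_lt_b : a < b)
    (rho_ge0 : {in `[a, b], forall x, 0 <= rho x})
    (rho_nondecreasing : {in `[a, b] &, {homo rho : x y / x <= y}})
    (rho_bounded : [bounded rho x | x in `[a, b]])
    (w_sol : solves_bvp a b rho w lambda)
    (w_gt1 : {in `]a, b[, forall x, 1 < w x}) :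
  (forall (w0 : R -> R) (lambda0 : R) (phi : R -> R),
     solves_bvp a b (fun=> 0) w0 lambda0 ->
     {in `]1, +oo[, forall t, 0 <= phi t} ->
     C1_on `]1, +oo[ phi ->
     {in `]1, +oo[ &, {homo phi : s t /~ s < t}} ->
     (\int[invx_measure R]_(x in `]a, b[) (phi (w0 x))%:E < +oo)%E ->
     (\int[invx_measure R]_(x in `]a, b[) (phi (w x))%:E >=
        \int[invx_measure R]_(x in `]a, b[) (phi (w0 x))%:E)%E /\
     ((\int[invx_measure R]_(x in `]a, b[) (phi (w x))%:E)%E =
        (\int[invx_measure R]_(x in `]a, b[) (phi (w0 x))%:E)%E <->
      {in `[a, b[, forall x, rho x = 0})) /\
  ((\int[invx_measure R]_(x in `]a, b[)
      ((Num.sqrt (w x ^+ 2 - 1))^-1)%:E >= pi%:E)%E /\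
   ((\int[invx_measure R]_(x in `]a, b[)
      ((Num.sqrt (w x ^+ 2 - 1))^-1)%:E)%E = pi%:E <->
    {in `[a, b[, forall x, rho x = 0})).
Proof.
(* The equation concerns the open interval only, so [rho = 0] on [[a, b[] makes [w] a solution of
   the problem with zero [rho]. *)
have uniq : {in `[a, b[, forall x, rho x = 0} ->
    {in `]a, b[, forall x, w x = bvp0_sol a b x}.
  move=> rho0 x xD; apply: (@bvp0_unique _ a b w lambda) => //; last first.
    exact: subset_itv_oo_cc xD.
  have [lw ode wa wb] := w_sol; split => //.
  apply: ae_lebesgueS ode => y h yD; have [dw wE] := h yD; split => //.
  by rewrite wE rho0//; move: yD; rewrite !in_itv/= => /andP[/ltW -> ->].
(* Phrased with the explicit [bvp0_sol]: uniqueness converts it into the claim on [w0], and the last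
   part is the case [1 / sqrt (t^2 - 1)], whose integral [pi] is finite. *)
have core (phi : R -> R) : {in `]1, +oo[, forall t, 0 <= phi t} ->
    {in `]1, +oo[, continuous phi} ->
    {in `]1, +oo[ &, {homo phi : s t /~ s < t}} ->
    (\int[invx_measure R]_(x in `]a, b[) (phi (bvp0_sol a b x))%:E < +oo)%E ->
    (\int[invx_measure R]_(x in `]a, b[) (phi (bvp0_sol a b x))%:E <=
      \int[invx_measure R]_(x in `]a, b[) (phi (w x))%:E)%E /\
    ((\int[invx_measure R]_(x in `]a, b[) (phi (w x))%:E)%E =
      (\int[invx_measure R]_(x in `]a, b[) (phi (bvp0_sol a b x))%:E)%E <->
      {in `[a, b[, forall x, rho x = 0}).
  move=> phi_ge0 phi_cont phi_decr fin; split.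
    exact: (integral_phi_ge a_gt0 a_lt_b rho_ge0 rho_nondecreasing w_sol w_gt1
      phi_ge0 phi_cont phi_decr).
  split=> [eqI x xab|rho0]; last first.
    by apply: eq_integral => x /set_mem xD; rewrite uniq.
  apply/eqP; rewrite eq_le rho_ge0 ?andbT; last exact: subset_itv_co_cc xab.
  rewrite leNgt; apply/negP => rx.
  exact: (integral_phi_neq a_gt0 a_lt_b rho_ge0 rho_nondecreasing w_sol w_gt1
    phi_ge0 phi_cont phi_decr xab rx fin) (esym eqI).
split=> [w0 lambda0 phi w0_sol phi_ge0 [dphi _] phi_decr fin|].
  have w0E : (\int[invx_measure R]_(x in `]a, b[) (phi (w0 x))%:E =
      \int[invx_measure R]_(x in `]a, b[) (phi (bvp0_sol a b x))%:E)%E.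
    apply: eq_integral => x /set_mem xD; congr (phi _)%:E.
    by apply: (bvp0_unique a_gt0 a_lt_b w0_sol); exact: subset_itv_oo_cc xD.
  rewrite w0E in fin *; apply: core => // t t1.
  by apply/differentiable_continuous/derivable1_diffP; exact: dphi.
rewrite -(integral_bvp0_sol_pi a_gt0 a_lt_b).
apply: (core (fun t => (Num.sqrt (t ^+ 2 - 1))^-1)).
- by move=> t _; rewrite invr_ge0 sqrtr_ge0.
- exact: continuous_inv_sqrt.
- exact: inv_sqrt_decr.
- by rewrite (integral_bvp0_sol_pi a_gt0 a_lt_b) ltry.
Qed.
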